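(* Let $K$ denote Kurepa's function. For every $x \in [0,1]$, $$K(x) \leq K'(0)\, x,$$ where $K'(0) = 1.432\,205\,735\ldots$ is the best possible constant (that is, if $c$ is a real number such that $K(x) \leq c\,x$ for all $x \in [0,1]$, then $c \geq K'(0)$).
   Context: Kurepa's function $K$ is defined by $$K(z) = \int_{0}^{\infty} e^{-t}\, \frac{t^{z}-1}{t-1}\, dt$$ for $\operatorname{Re}(z) > 0$, and is extended by analytic continuation to a meromorphic function with simple poles at $z=-1$ and $z=-n$ for integers $n \geq 3$. In particular $K$ is analytic at $z=0$, and $K'(0)$ denotes the derivative of this function at $0$.
   Formalization: The value 1.432 205 735… is read as rounded to nine decimals, that is, K'(0) is within 5·10⁻¹⁰ of 1.432205735; read as a decimal expansion it would be false, since K'(0) = 1.43220573465…. *)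

(* Defs.v *)
From Stdlib Require Import Reals.
From Coquelicot Require Import Coquelicot.
Open Scope R_scope.

Definition Cexp (z : C) : C := (exp (Re z) * cos (Im z), exp (Re z) * sin (Im z)).

(* [t ^ z] on the principal branch; only its values for [0 < t] are meaningful. *)
Definition Rpower_C (t : R) (z : C) : C := Cexp (z * RtoC (ln t))%C.

(* The values at the single points [t = 0] and [t = 1] are junk, and do not
   affect the integral: both singularities are removable when [0 < Re z]. *)
Definition kurepa_integrand (z : C) (t : R) : C :=
  (RtoC (exp (- t)) * ((Rpower_C t z - 1) / (RtoC t - 1)))%C.

Definition kurepa_pole (p : C) : Prop :=
  p = RtoC (-1) \/ exists n : nat, (3 <= n)%nat /\ p = RtoC (- INR n).

(* [locally'] is the filter of punctured neighbourhoods. *)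
Definition simple_pole (f : C -> C) (p : C) : Prop :=
  exists r : C, r <> RtoC 0 /\
    filterlim (fun z : C => ((z - p) * f z)%C)
      (@locally' C_UniformSpace p) (@locally C_UniformSpace r).

(* The set of non-poles is open and connected, so that these conditions
   determine [K] there; the values of [K] at its poles are left arbitrary.
   Analyticity is complex differentiability on that open set. *)
Record is_kurepa (K : C -> C) : Prop := {
  kurepa_integral : forall z : C, 0 < Re z ->
    @is_RInt_gen C_R_NormedModule (kurepa_integrand z)
      (at_point 0) (Rbar_locally p_infty) (K z);
  kurepa_analytic : forall z : C, ~ kurepa_pole z ->
    @ex_derive C_AbsRing C_NormedModule K z;
  kurepa_simple_poles : forall p : C, kurepa_pole p -> simple_pole K p
}.

(* Main.v *)
Require Import Defs.
From Stdlib Require Import Reals Factorial Lra Lia Psatz ZArith.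
From Coquelicot Require Import Coquelicot.
Open Scope R_scope.

(** The inequality comes from a convexity argument at positive arguments only.
For a fixed t > 0 put u = ln t. The third divided difference of x |-> e^(xu)
has the sign of u^3, hence that of (t - 1), so the integrand of K, as a
function of x, has nonnegative third divided differences for every t.
Integrating over t, with nodes 0 < y < x <= 1 and the value 0 at the node 0,
this reads
  K(x) - (x/y) K(y) <= x(x-y)/(1-y) (K(1) - K(y)/y)
([kurepa_three_point]). Let y tend to 0: K(y)/y tends to k = K'(0), and
K(1) <= 1 < k, so that the right-hand side is eventually negative and
K(x) <= k x remains. The constant is best possible because k is the limit of
K(y)/y. The function K is known at 0 only through differentiability; the bound
|K(y)| = O(y) forces K(0) = 0, and the vanishing of Im K(y) makes the
derivative real ([kurepa_at_0]).

The comparison 1 < k and the nine decimals come from a rigorous evaluation of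
  e k = e * int_0^oo e^(-t) ln t / (t-1) dt,
obtained as a bound on e K(y)/y that is uniform in y up to O(y)
([kurepa_slope]). The part of the integral beyond t = 32 is at most e^(-32).
On (0, 32] put s = t - 1 and split
  e^(-s) ln t / s = ln t / s + ln t (e^(-s) - 1)/s.
In the second term e^(-s) is replaced by a Taylor polynomial of such high
degree (110) that it is accurate up to s = 31; powers of s times ln t have
elementary primitives ([is_derive_log_exp_primitive]). The first term has a
dilogarithm as primitive, which the functional equations
t -> 1-t, t -> 1/t, t -> 1-1/t express on each of [0, 1/2], [1/2, 1], [1, 2],
[2, 32] by truncated series at an argument of size at most 1/2. Only ln 2, e
and rational numbers occur in the result ([slope_approx]); the rational
numbers are evaluated exactly in integer arithmetic.

The integrals over these intervals are compared with primitives through the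
mean value theorem ([RInt_close_primitive]), with error densities bounded by a multiple of
1/sqrt t: this is integrable at 0 and absorbs the logarithmic singularity
there. *)

(** * Comparing an integral with a primitive *)

Lemma le_of_forall_pos (a b : R) : (forall eps, 0 < eps -> a <= b + eps) -> a <= b.
Proof. intros H. apply Rnot_lt_le. intros Hc. specialize (H ((a - b) / 2) ltac:(lra)). lra. Qed.

Lemma eq_0_of_small (a : R) : (forall eps, 0 < eps -> Rabs a <= eps) -> a = 0.
Proof.
intros H. assert (H0 : Rabs a <= 0) by (apply le_of_forall_pos; intros eps He; specialize (H eps He); lra).
apply Rabs_le_between in H0. lra.
Qed.

Lemma le_of_derive_nonneg (g : R -> R) (a b : R) :
  a <= b ->
  (forall t, a <= t <= b -> continuous g t) ->
  (forall t, a < t < b -> exists l : R, 0 <= l /\ is_derive g t l) ->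
  g a <= g b.
Proof.
intros Hab Hc Hd.
destruct (Rle_lt_or_eq_dec a b Hab) as [Hlt | ->]; [ | lra ].
assert (pr1 : forall c, a < c < b -> derivable_pt g c).
{ intros c Hcab. apply ex_derive_Reals_0.
  destruct (Hd c Hcab) as [l [_ Hl]]. now exists l. }
assert (pr2 : forall c, a < c < b -> derivable_pt id c).
{ intros c _. apply derivable_pt_id. }
destruct (MVT g id a b pr1 pr2 Hlt) as [c [Pc Heq]].
- intros c Hcab. apply continuity_pt_filterlim. now apply Hc.
- intros c _. apply derivable_continuous_pt, derivable_pt_id.
- replace (derive_pt id c (pr2 c Pc)) with 1 in Heq
    by (symmetry; rewrite derive_pt_eq; apply derivable_pt_lim_id).
  unfold id in Heq.
  destruct (Hd c Pc) as [l [Hl0 Hl]].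
  assert (Hdl : derive_pt g c (pr1 c Pc) = l).
  { rewrite derive_pt_eq. now apply is_derive_Reals. }
  rewrite Hdl in Heq. nra.
Qed.

(** The derivative of F may be unbounded at the endpoints, as for t ln t at 0,
so it need not be integrable and the fundamental theorem does not apply to it.
Instead F minus the running integral of f is monotone. *)
Lemma RInt_le_primitive (f F : R -> R) (a b I : R) :
  a <= b -> is_RInt f a b I ->
  (forall t, a < t < b -> continuous f t) ->
  (forall t, a <= t <= b -> continuous F t) ->
  (forall t, a < t < b -> exists l : R, is_derive F t l /\ f t <= l) ->
  I <= F b - F a.
Proof.
intros Hab HI Hf HF Hd.
(* Extending f by 0 makes the running integral defined, hence continuous, on a
   neighbourhood of both endpoints. *)
set (f0 := fun t => if Rlt_dec a t then if Rlt_dec t b then f t else 0 else 0).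
assert (H1 : is_RInt f0 (a - 1) a 0).
{ apply (is_RInt_ext (fun _ => 0)).
  - intros t. rewrite Rmin_left, Rmax_right by lra. intros Ht.
    unfold f0. destruct (Rlt_dec a t); [lra | reflexivity].
  - evar_last; [apply (is_RInt_const (V := R_NormedModule)) | apply (scal_zero_r (V := R_NormedModule))]. }
assert (H2 : is_RInt f0 a b I).
{ apply (is_RInt_ext f); [ | exact HI].
  intros t. rewrite Rmin_left, Rmax_right by lra. intros Ht.
  unfold f0. destruct (Rlt_dec a t); [ | lra]. destruct (Rlt_dec t b); [reflexivity | lra]. }
assert (H3 : is_RInt f0 b (b + 1) 0).
{ apply (is_RInt_ext (fun _ => 0)).
  - intros t. rewrite Rmin_left, Rmax_right by lra. intros Ht.
    unfold f0. destruct (Rlt_dec a t); [ | reflexivity].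
    destruct (Rlt_dec t b); [lra | reflexivity].
  - evar_last; [apply (is_RInt_const (V := R_NormedModule)) | apply (scal_zero_r (V := R_NormedModule))]. }
assert (Hex : forall t, a - 1 <= t <= b + 1 -> ex_RInt f0 a t).
{ intros t Ht.
  assert (H : @ex_RInt R_NormedModule f0 (a - 1) (b + 1)).
  { eexists. eapply is_RInt_Chasles; [eapply is_RInt_Chasles; eassumption | eassumption]. }
  assert (H' : @ex_RInt R_NormedModule f0 (a - 1) t) by (apply (ex_RInt_Chasles_1 (V := R_CompleteNormedModule)) with (b + 1); [lra | exact H]).
  apply (ex_RInt_Chasles (V := R_NormedModule)) with (a - 1); [ | exact H'].
  apply ex_RInt_swap. eexists; exact H1. }
assert (Hloc : forall t, a <= t <= b -> locally t (fun z => is_RInt f0 a z (RInt f0 a z))).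
{ intros t Ht. exists (mkposreal 1 Rlt_0_1). intros z Hz.
  change (Rabs (z - t) < 1) in Hz. apply Rabs_def2 in Hz.
  apply (RInt_correct (V := R_CompleteNormedModule)). apply Hex. lra. }
assert (Hle : F a - RInt f0 a a <= F b - RInt f0 a b).
{ apply (le_of_derive_nonneg (fun t => F t - RInt f0 a t)); [exact Hab | | ].
  - intros t Ht. apply (continuous_minus F (fun z => RInt f0 a z)); [now apply HF | ].
    apply (continuous_RInt_1 (V := R_NormedModule) f0 a t (fun z => RInt f0 a z)).
    now apply Hloc.
  - intros t Ht. destruct (Hd t Ht) as [l [Hl Hle]].
    exists (l - f0 t). split.
    + unfold f0. destruct (Rlt_dec a t); [ | lra]. destruct (Rlt_dec t b); lra.
    + apply (is_derive_minus (V := R_NormedModule)); [exact Hl | ].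
      apply (is_derive_RInt (V := R_NormedModule) f0 (fun z => RInt f0 a z) a t).
      * apply Hloc; lra.
      * apply (continuous_ext_loc _ f); [ | now apply Hf].
        assert (Hd0 : 0 < Rmin (t - a) (b - t)) by (apply Rmin_glb_lt; lra).
        exists (mkposreal _ Hd0). intros z Hz. change (Rabs (z - t) < Rmin (t - a) (b - t)) in Hz.
        apply Rabs_def2 in Hz.
        pose proof (Rmin_l (t - a) (b - t)). pose proof (Rmin_r (t - a) (b - t)).
        unfold f0. destruct (Rlt_dec a z); [ | lra]. destruct (Rlt_dec z b); [reflexivity | lra]. }
assert (E0 : RInt f0 a a = 0) by (rewrite RInt_point; reflexivity).
assert (E1 : RInt f0 a b = I) by (apply (is_RInt_unique (V := R_CompleteNormedModule)); exact H2).
rewrite E0, E1 in Hle. lra.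
Qed.

Lemma RInt_split (f : R -> R) (a b c I : R) :
  a <= b <= c -> is_RInt f a c I ->
  exists I1 I2, is_RInt f a b I1 /\ is_RInt f b c I2 /\ I = I1 + I2.
Proof.
intros Habc HI.
assert (Hex : @ex_RInt R_NormedModule f a c) by (now exists I).
destruct (ex_RInt_Chasles_1 (V := R_CompleteNormedModule) f a b c Habc Hex) as [I1 H1].
destruct (ex_RInt_Chasles_2 (V := R_CompleteNormedModule) f a b c Habc Hex) as [I2 H2].
exists I1, I2. split; [exact H1 | split; [exact H2 | ]].
pose proof (is_RInt_Chasles (V := R_NormedModule) _ _ _ _ _ _ H1 H2) as HS.
apply (is_RInt_unique (V := R_CompleteNormedModule)) in HI.
apply (is_RInt_unique (V := R_CompleteNormedModule)) in HS.
rewrite <- HI. exact HS.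
Qed.

Lemma continuous_sqrt_nonneg (t : R) : 0 <= t -> continuous sqrt t.
Proof. intros Ht. apply continuity_pt_filterlim, continuity_pt_sqrt, Ht. Qed.

(** An error density eta/sqrt t integrates to 2 eta (sqrt b - sqrt a), so the
errors of consecutive intervals telescope. *)
Lemma RInt_close_primitive (f F : R -> R) (a b I eta : R) :
  0 <= a -> a <= b -> is_RInt f a b I ->
  (forall t, a < t < b -> continuous f t) ->
  (forall t, a <= t <= b -> continuous F t) ->
  (forall t, a < t < b -> exists l : R, is_derive F t l /\ Rabs (f t - l) <= eta / sqrt t) ->
  Rabs (I - (F b - F a)) <= 2 * eta * (sqrt b - sqrt a).
Proof.
intros Ha Hab HI Hf HF Hd.
assert (Hs : forall t, a < t -> is_derive (fun u => 2 * eta * sqrt u) t (eta / sqrt t)).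
{ intros t Ht. auto_derive; [lra | ]. field. apply Rgt_not_eq, sqrt_lt_R0. lra. }
assert (Hsc : forall t, a <= t -> continuous (fun u => 2 * eta * sqrt u) t).
{ intros t Ht. apply (continuous_mult (fun _ => 2 * eta) sqrt); [apply continuous_const | ].
  apply continuous_sqrt_nonneg. lra. }
apply Rabs_le. split.
- assert (H : - I <= (- F b + 2 * eta * sqrt b) - (- F a + 2 * eta * sqrt a)).
  { apply (RInt_le_primitive (fun t => - f t) (fun t => - F t + 2 * eta * sqrt t)); [lra | | | | ].
    - now apply (is_RInt_opp (V := R_NormedModule)).
    - intros t Ht. apply (continuous_opp (V := R_NormedModule) f). now apply Hf.
    - intros t Ht. apply (continuous_plus (fun t => - F t) (fun u => 2 * eta * sqrt u)); [ | apply Hsc; lra].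
      apply (continuous_opp (V := R_NormedModule) F). now apply HF.
    - intros t Ht. destruct (Hd t Ht) as [l [Hl Hb]]. exists (- l + eta / sqrt t). split.
      + apply (is_derive_plus (V := R_NormedModule) (fun t => - F t) (fun u => 2 * eta * sqrt u)); [ | apply Hs; lra].
        now apply (is_derive_opp (V := R_NormedModule)).
      + apply Rabs_le_between in Hb. lra. }
  lra.
- assert (H : I <= (F b + 2 * eta * sqrt b) - (F a + 2 * eta * sqrt a)).
  { apply (RInt_le_primitive f (fun t => F t + 2 * eta * sqrt t)); [lra | exact HI | exact Hf | | ].
    - intros t Ht. apply (continuous_plus F (fun u => 2 * eta * sqrt u)); [ | apply Hsc; lra].
      now apply HF.
    - intros t Ht. destruct (Hd t Ht) as [l [Hl Hb]]. exists (l + eta / sqrt t). split.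
      + apply (is_derive_plus (V := R_NormedModule) F (fun u => 2 * eta * sqrt u)); [exact Hl | apply Hs; lra].
      + apply Rabs_le_between in Hb. lra. }
  lra.
Qed.

(** * Truncated series for the exponential and the logarithm *)

(** There are N terms, hence the degree is N - 1; with this indexing the
derivative lowers N by exactly one. *)
Fixpoint exp_poly (N : nat) (x : R) : R :=
  match N with O => 0 | S n => exp_poly n x + x ^ n / INR (fact n) end.

Lemma is_derive_pow_div (n : nat) (x : R) :
  is_derive (fun u => u ^ S n / INR (S n)) x (x ^ n).
Proof.
pose proof (lt_0_INR (S n) ltac:(lia)).
evar_last.
- apply (is_derive_ext (fun u => / INR (S n) * u ^ S n)).
  + intros u. unfold Rdiv. apply Rmult_comm.
  + apply is_derive_scal. apply is_derive_pow. apply (is_derive_id (K := R_AbsRing)).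
- change (/ INR (S n) * (INR (S n) * 1 * x ^ n) = x ^ n). field. lra.
Qed.

Lemma is_derive_exp_poly (N : nat) (x : R) :
  is_derive (exp_poly (S N)) x (exp_poly N x).
Proof.
induction N as [ | N IH].
- simpl. auto_derive; [exact I | ]. lra.
- change (is_derive (fun u => exp_poly (S N) u + u ^ S N / INR (fact (S N))) x
    (exp_poly N x + x ^ N / INR (fact N))).
  apply (is_derive_plus (V := R_NormedModule)); [exact IH | ].
  pose proof (INR_fact_lt_0 N). pose proof (lt_0_INR (S N) ltac:(lia)).
  apply (is_derive_ext (fun u => / INR (fact N) * (u ^ S N / INR (S N)))).
  + intros u. change (fact (S N)) with (S N * fact N)%nat. rewrite mult_INR. 
    change (/ INR (fact N) * (u ^ S N / INR (S N)) = u ^ S N / (INR (S N) * INR (fact N))). field. lra.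
  + unfold Rdiv. rewrite (Rmult_comm (x ^ N)). apply is_derive_scal, is_derive_pow_div.
Qed.

Lemma exp_poly_0 (N : nat) : exp_poly (S N) 0 = 1.
Proof.
induction N as [ | N IH]; [simpl; lra | ].
change (exp_poly (S N) 0 + 0 ^ S N / INR (fact (S N)) = 1).
rewrite IH, pow_i by lia. unfold Rdiv. ring.
Qed.

(** By induction on N: the error for N + 1 terms vanishes at 0 and its derivative
is the error for N terms. The sign s treats the two half-lines at once, and
gives on the negative one a bound free of the growth of exp. *)
Lemma exp_poly_error (s X M : R) (N : nat) :
  Rabs s = 1 -> 
  (forall x, 0 <= x <= X -> exp (s * x) <= M) ->
  forall x, 0 <= x <= X ->
  Rabs (exp (s * x) - exp_poly N (s * x)) <= M * x ^ N / INR (fact N).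
Proof.
intros Hs HM. induction N as [ | N IH]; intros x Hx.
- simpl. rewrite Rminus_0_r, Rabs_pos_eq by (apply Rlt_le, exp_pos).
  specialize (HM x Hx). lra.
- assert (Hstep : forall d, Rabs d = 1 -> 
    0 <= M * x ^ S N / INR (fact (S N)) - d * (exp (s * x) - exp_poly (S N) (s * x))).
  { intros d Hd.
    set (G := fun u => M * u ^ S N / INR (fact (S N)) - d * (exp (s * u) - exp_poly (S N) (s * u))).
    assert (HG : forall u, is_derive G u
      (M * u ^ N / INR (fact N) - d * (s * exp (s * u) - s * exp_poly N (s * u)))).
    { intros u. apply (is_derive_minus (V := R_NormedModule)).
      - pose proof (INR_fact_lt_0 N). pose proof (lt_0_INR (S N) ltac:(lia)).
        replace (M * u ^ N / INR (fact N)) with (M / INR (fact N) * u ^ N) by (field; lra).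
        apply (is_derive_ext (fun u => M / INR (fact N) * (u ^ S N / INR (S N)))).
        + intros v. change (fact (S N)) with (S N * fact N)%nat. rewrite mult_INR.
          change (M / INR (fact N) * (v ^ S N / INR (S N)) = M * v ^ S N / (INR (S N) * INR (fact N))).
          field. lra.
        + apply is_derive_scal, is_derive_pow_div.
      - apply is_derive_scal. apply (is_derive_minus (V := R_NormedModule)).
        + auto_derive; [exact I | ring].
        + apply (is_derive_comp (V := R_NormedModule) (exp_poly (S N)) (fun u => s * u)).
          * apply is_derive_exp_poly.
          * auto_derive; [exact I | ring]. }
    assert (H0 : G 0 = 0).
    { unfold G. rewrite Rmult_0_r, exp_0, exp_poly_0, pow_i by lia. unfold Rdiv. ring. }
    rewrite <- H0. change (G 0 <= G x).
    apply le_of_derive_nonneg; [lra | | ].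
    - intros u _. apply (ex_derive_continuous (V := R_NormedModule)). eexists. apply HG.
    - intros u Hu. eexists. split; [ | apply HG].
      specialize (IH u ltac:(lra)).
      replace (d * (s * exp (s * u) - s * exp_poly N (s * u)))
        with ((d * s) * (exp (s * u) - exp_poly N (s * u))) by ring.
      pose proof (Rle_abs ((d * s) * (exp (s * u) - exp_poly N (s * u)))) as Hab.
      rewrite !Rabs_mult, Hd, Hs in Hab. lra. }
  pose proof (Hstep 1 Rabs_R1). pose proof (Hstep (-1) ltac:(rewrite Rabs_left; lra)).
  apply Rabs_le. lra.
Qed.

Fixpoint log_poly (N : nat) (v : R) : R :=
  match N with O => 0 | S n => log_poly n v + v ^ S n / INR (S n) end.

Fixpoint dilog_poly (N : nat) (v : R) : R :=
  match N with O => 0 | S n => dilog_poly n v + v ^ S n / INR (S n) / INR (S n) end.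

Lemma is_derive_log_poly (N : nat) (v : R) :
  v <> 1 -> is_derive (log_poly N) v ((1 - v ^ N) / (1 - v)).
Proof.
intros Hv. induction N as [ | N IH].
- simpl. evar_last; [apply (is_derive_const (V := R_NormedModule)) | ]. 
  change (0 = (1 - 1) / (1 - v)). field. lra.
- evar_last.
  + apply (is_derive_plus (V := R_NormedModule) (log_poly N) (fun u => u ^ S N / INR (S N))).
    * exact IH.
    * apply is_derive_pow_div.
  + change ((1 - v ^ N) / (1 - v) + v ^ N = (1 - v * v ^ N) / (1 - v)). field. lra.
Qed.

Lemma is_derive_dilog_poly (N : nat) (v : R) :
  v <> 0 -> is_derive (dilog_poly N) v (log_poly N v / v).
Proof.
intros Hv. induction N as [ | N IH].
- simpl. evar_last; [apply (is_derive_const (V := R_NormedModule)) | ].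
  change (0 = 0 / v). field. exact Hv.
- pose proof (lt_0_INR (S N) ltac:(lia)).
  evar_last.
  + apply (is_derive_plus (V := R_NormedModule) (dilog_poly N) (fun u => u ^ S N / INR (S N) / INR (S N))).
    * exact IH.
    * apply (is_derive_ext (fun u => / INR (S N) * (u ^ S N / INR (S N)))).
      -- intros u. change (/ INR (S N) * (u ^ S N / INR (S N)) = u ^ S N / INR (S N) / INR (S N)).
         field. lra.
      -- apply is_derive_scal, is_derive_pow_div.
  + change (log_poly N v / v + / INR (S N) * v ^ N = (log_poly N v + v ^ S N / INR (S N)) / v).
    rewrite <- (tech_pow_Rmult v N). field. split; first [exact Hv | lra].
Qed.

Lemma continuous_log_poly (N : nat) (v : R) : continuous (log_poly N) v.
Proof.
induction N as [ | N IH]; [apply continuous_const | ].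
apply (continuous_plus (log_poly N) (fun u => u ^ S N / INR (S N))); [exact IH | ].
apply (ex_derive_continuous (V := R_NormedModule)). eexists. apply is_derive_pow_div.
Qed.

Lemma continuous_dilog_poly (N : nat) (v : R) : continuous (dilog_poly N) v.
Proof.
induction N as [ | N IH]; [apply continuous_const | ].
apply (continuous_plus (dilog_poly N) (fun u => u ^ S N / INR (S N) / INR (S N))); [exact IH | ].
apply (continuous_mult (fun u => u ^ S N / INR (S N)) (fun _ => / INR (S N))); [ | apply continuous_const].
apply (ex_derive_continuous (V := R_NormedModule)). eexists. apply is_derive_pow_div.
Qed.

Lemma log_poly_0 (N : nat) : log_poly N 0 = 0.
Proof.
induction N as [ | N IH]; [reflexivity | ].
change (log_poly N 0 + 0 ^ S N / INR (S N) = 0). rewrite IH, pow_i by lia. unfold Rdiv. ring.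
Qed.

Lemma dilog_poly_0 (N : nat) : dilog_poly N 0 = 0.
Proof.
induction N as [ | N IH]; [reflexivity | ].
change (dilog_poly N 0 + 0 ^ S N / INR (S N) / INR (S N) = 0). rewrite IH, pow_i by lia. unfold Rdiv. ring.
Qed.

(** The error vanishes at 0 and has derivative v^N/(1-v), which lies between 0 and
2 (1/2)^N on [0, 1/2]. Keeping the factor v in the bound allows the division
by v needed for the dilogarithm. *)
Lemma log_poly_error (N : nat) (v : R) :
  0 <= v <= 1 / 2 -> 0 <= - ln (1 - v) - log_poly N v <= 2 * (1 / 2) ^ N * v.
Proof.
intros Hv.
assert (Hd : forall u, u < 1 -> is_derive (fun u => - ln (1 - u) - log_poly N u) u (u ^ N / (1 - u))).
{ intros u Hu.
  evar_last.
  - apply (is_derive_minus (V := R_NormedModule) (fun u => - ln (1 - u)) (log_poly N)).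
    + instantiate (1 := / (1 - u)). auto_derive; [lra | field; lra].
    + apply is_derive_log_poly. lra.
  - change (/ (1 - u) - (1 - u ^ N) / (1 - u) = u ^ N / (1 - u)). field. lra. }
assert (H0 : - ln (1 - 0) - log_poly N 0 = 0) by (rewrite log_poly_0, !Rminus_0_r, ln_1; ring).
split.
- rewrite <- H0. apply (le_of_derive_nonneg (fun u => - ln (1 - u) - log_poly N u)); [lra | | ].
  + intros t Ht. apply (ex_derive_continuous (V := R_NormedModule)). eexists. apply Hd. lra.
  + intros t Ht. eexists. split; [ | apply Hd; lra].
    apply Rdiv_le_0_compat; [apply pow_le; lra | lra].
- enough (0 <= 2 * (1 / 2) ^ N * v - (- ln (1 - v) - log_poly N v)) by lra.
  replace 0 with (2 * (1 / 2) ^ N * 0 - (- ln (1 - 0) - log_poly N 0)) by (rewrite H0; ring).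
  assert (Hd' : forall u, u < 1 -> is_derive (fun u => 2 * (1 / 2) ^ N * u - (- ln (1 - u) - log_poly N u)) u
     (2 * (1 / 2) ^ N - u ^ N / (1 - u))).
  { intros u Hu. apply (is_derive_minus (V := R_NormedModule) (fun u => 2 * (1 / 2) ^ N * u)); [ | now apply Hd].
    auto_derive; [exact I | ring]. }
  apply (le_of_derive_nonneg (fun u => 2 * (1 / 2) ^ N * u - (- ln (1 - u) - log_poly N u))); [lra | | ].
  + intros t Ht. apply (ex_derive_continuous (V := R_NormedModule)). eexists. apply Hd'. lra.
  + intros t Ht. eexists. split; [ | apply Hd'; lra].
    assert (t ^ N <= (1 / 2) ^ N) by (apply pow_incr; lra).
    assert (t ^ N / (1 - t) <= 2 * (1 / 2) ^ N); [ | lra].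
    apply Rle_div_l; [lra | ]. pose proof (pow_le (1 / 2) N ltac:(lra)). nra.
Qed.

Lemma ln_le_sub_one (x : R) : 0 < x -> ln x <= x - 1.
Proof. intros Hx. pose proof (exp_ineq1_le (ln x)) as H. rewrite exp_ln in H by exact Hx. lra. Qed.

Lemma one_sub_inv_le_ln (x : R) : 0 < x -> 1 - / x <= ln x.
Proof.
intros Hx. pose proof (ln_le_sub_one (/ x) (Rinv_0_lt_compat _ Hx)) as H.
rewrite ln_Rinv in H by exact Hx. lra.
Qed.

(** With r = sqrt t, use ln t = 2 ln r and 1 - 1/r <= ln r <= r - 1. *)
Lemma log_quotient_bounds (t : R) : 0 < t -> t <> 1 -> 0 <= ln t / (t - 1) <= 2 / sqrt t.
Proof.
intros Ht H1. pose proof (sqrt_lt_R0 t Ht) as Hr. set (r := sqrt t) in *.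
assert (Er : t = r * r) by (symmetry; apply sqrt_sqrt; lra).
assert (El : ln t = 2 * ln r) by (rewrite Er, ln_mult by lra; ring).
pose proof (ln_le_sub_one r Hr) as Hu. pose proof (one_sub_inv_le_ln r Hr) as Hl.
assert (Hri : r * / r = 1) by (field; lra). pose proof (Rinv_0_lt_compat r Hr) as Hi.
rewrite El. destruct (Rlt_or_le 1 r) as [Hc | Hc].
- assert (0 < t - 1) by nra. split.
  + apply Rdiv_le_0_compat; [nra | assumption].
  + apply Rle_div_l; [assumption | ]. apply Rle_trans with (2 * (r - 1)); [lra | ].
    replace (2 / r * (t - 1)) with (2 * (r - / r)) by (rewrite Er; field; lra). nra.
- assert (r <> 1) by (intros E; rewrite E in Er; lra).
  assert (0 < 1 - t) by nra.
  replace (2 * ln r / (t - 1)) with (2 * - ln r / (1 - t)) by (field; lra). split.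
  + apply Rdiv_le_0_compat; [nra | assumption].
  + apply Rle_div_l; [assumption | ]. apply Rle_trans with (2 * (/ r - 1)); [lra | ].
    replace (2 / r * (1 - t)) with (2 * (/ r - r)) by (rewrite Er; field; lra). nra.
Qed.

(** As [ln] is 0 on nonpositive reals, u ln u is continuous at 0 from both sides.
For small u > 0 it is squeezed by 2 sqrt u. *)
Lemma continuous_mul_ln (t : R) : 0 <= t -> continuous (fun u => u * ln u) t.
Proof.
intros Ht. destruct (Rle_lt_or_eq_dec 0 t Ht) as [Hlt | <-].
- apply (ex_derive_continuous (V := R_NormedModule)). auto_derive. exact Hlt.
- intros P HP.
  change (filtermap (fun u => u * ln u) (locally 0) P).
  rewrite Rmult_0_l in HP. destruct HP as [eps Heps].
  assert (He : 0 < Rmin (1 / 4) (eps / 2 * (eps / 2))).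
  { destruct eps as [e He]; simpl. apply Rmin_glb_lt; nra. }
  exists (mkposreal _ He). intros u Hu. apply Heps.
  change (Rabs (u - 0) < Rmin (1 / 4) (eps / 2 * (eps / 2))) in Hu.
  change (Rabs (u * ln u - 0) < eps). rewrite Rminus_0_r in *.
  pose proof (Rmin_l (1 / 4) (eps / 2 * (eps / 2))). pose proof (Rmin_r (1 / 4) (eps / 2 * (eps / 2))).
  apply Rabs_def2 in Hu. destruct eps as [e He']; simpl in *.
  destruct (Rlt_or_le 0 u) as [Hp | Hn].
  + pose proof (sqrt_lt_R0 u Hp) as Hr. set (r := sqrt u) in *.
    assert (Er : u = r * r) by (symmetry; apply sqrt_sqrt; lra).
    assert (El : ln u = 2 * ln r) by (rewrite Er, ln_mult by lra; ring).
    pose proof (one_sub_inv_le_ln r Hr) as Hl. pose proof (ln_le_sub_one r Hr).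
    assert (u < e / 2 * (e / 2) /\ u < 1) as [Hu1 Hu2] by lra.
    assert (r < e / 2) by (apply Rnot_le_lt; intros Hc; nra). assert (r < 1) by (apply Rnot_le_lt; intros Hc; nra).
    assert (r * / r = 1) by (field; lra).
    assert (Hm : - r <= r * r * ln r). { assert (- 1 <= r * ln r) by nra. nra. }
    rewrite El, Er. apply Rabs_def1; nra.
  + assert (ln u = 0) as ->.
    { unfold ln. destruct (Rlt_dec 0 u); [exfalso; lra | reflexivity]. }
    rewrite Rmult_0_r, Rabs_R0. exact He'.
Qed.

(** * Primitives of powers of t - 1 times ln t *)

(** The quotient (s^n - (-1)^n)/(s + 1) as a polynomial. *)
Fixpoint alt_geo (n : nat) (s : R) : R :=
  match n with O => 0 | S m => s ^ m - alt_geo m s end.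

(** A primitive of [alt_geo n]; the recursion fixes the constant of integration
so that the value at 0 is 0. *)
Fixpoint alt_log (n : nat) (s : R) : R :=
  match n with O => 0 | S m => s ^ S m / INR (S m) - alt_log m s end.

Lemma alt_geo_mul (n : nat) (s : R) : (s + 1) * alt_geo n s = s ^ n - (-1) ^ n.
Proof. induction n as [ | n IH]; simpl; [ring | ]. rewrite Rmult_minus_distr_l, IH. ring. Qed.

Lemma is_derive_alt_log (n : nat) (s : R) : is_derive (alt_log n) s (alt_geo n s).
Proof.
induction n as [ | n IH]; [apply (is_derive_const (V := R_NormedModule)) | ].
apply (is_derive_minus (V := R_NormedModule) (fun u => u ^ S n / INR (S n)) (alt_log n)); [ | exact IH].
apply is_derive_pow_div.
Qed.

(** The polynomial approximation of (e^(-s) - 1)/s, see [exp_quot_spec]. *)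
Fixpoint exp_quot (N : nat) (s : R) : R :=
  match N with O => 0 | S n => exp_quot n s + (-1) ^ S n * s ^ n / INR (fact (S n)) end.

Lemma exp_quot_spec (N : nat) (s : R) : 1 + s * exp_quot N s = exp_poly (S N) (- s).
Proof.
induction N as [ | N IH]; [simpl; field | ].
change (1 + s * (exp_quot N s + (-1) ^ S N * s ^ N / INR (fact (S N))) =
  exp_poly (S N) (- s) + (- s) ^ S N / INR (fact (S N))).
rewrite <- IH. replace (- s) with (-1 * s) at 1 by ring. rewrite Rpow_mult_distr, <- (tech_pow_Rmult s N).
pose proof (INR_fact_lt_0 (S N)). field. lra.
Qed.

(** The primitive of [exp_quot N] that vanishes at s = -1, that is, at t = 0: this
choice is what makes its product with ln t continuous at t = 0. *)
Fixpoint log_exp_coeff (N : nat) (s : R) : R :=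
  match N with O => 0 | S n => log_exp_coeff n s + (-1) ^ S n / INR (fact (S n)) / INR (S n) * (s ^ S n - (-1) ^ S n) end.

(** A primitive of [log_exp_coeff N s] / (s + 1), the term left over by the
integration by parts in [log_exp_primitive]. *)
Fixpoint log_exp_rest (N : nat) (s : R) : R :=
  match N with O => 0 | S n => log_exp_rest n s + (-1) ^ S n / INR (fact (S n)) / INR (S n) * alt_log (S n) s end.

Definition log_exp_primitive (N : nat) (t : R) : R := log_exp_coeff N (t - 1) * ln t - log_exp_rest N (t - 1).

Lemma is_derive_log_exp_coeff (N : nat) (s : R) : is_derive (log_exp_coeff N) s (exp_quot N s).
Proof.
induction N as [ | N IH]; [apply (is_derive_const (V := R_NormedModule)) | ].
pose proof (INR_fact_lt_0 (S N)). pose proof (lt_0_INR (S N) ltac:(lia)).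
apply (is_derive_plus (V := R_NormedModule) (log_exp_coeff N)); [exact IH | ].
apply (is_derive_ext (fun u => (-1) ^ S N / INR (fact (S N)) * (u ^ S N / INR (S N) - (-1) ^ S N / INR (S N)))).
{ intros u. change ((-1) ^ S N / INR (fact (S N)) * (u ^ S N / INR (S N) - (-1) ^ S N / INR (S N))
    = (-1) ^ S N / INR (fact (S N)) / INR (S N) * (u ^ S N - (-1) ^ S N)). field. lra. }
evar_last.
- apply is_derive_scal, (is_derive_minus (V := R_NormedModule)); [apply is_derive_pow_div | apply (is_derive_const (V := R_NormedModule))].
- change ((-1) ^ S N / INR (fact (S N)) * (s ^ N - 0) = (-1) ^ S N * s ^ N / INR (fact (S N))). field. lra.
Qed.

Lemma is_derive_log_exp_rest (N : nat) (s : R) :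
  s <> -1 -> is_derive (log_exp_rest N) s (log_exp_coeff N s / (s + 1)).
Proof.
intros Hs. induction N as [ | N IH].
- evar_last; [apply (is_derive_const (V := R_NormedModule)) | ].
  change (0 = 0 / (s + 1)). field. lra.
- pose proof (INR_fact_lt_0 (S N)). pose proof (lt_0_INR (S N) ltac:(lia)).
  evar_last.
  + apply (is_derive_plus (V := R_NormedModule) (log_exp_rest N)); [exact IH | ].
    apply is_derive_scal, is_derive_alt_log.
  + change (log_exp_coeff N s / (s + 1) + (-1) ^ S N / INR (fact (S N)) / INR (S N) * alt_geo (S N) s
     = (log_exp_coeff N s + (-1) ^ S N / INR (fact (S N)) / INR (S N) * (s ^ S N - (-1) ^ S N)) / (s + 1)).
    rewrite <- alt_geo_mul. field. lra.
Qed.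

Lemma is_derive_log_exp_primitive (N : nat) (t : R) :
  0 < t -> is_derive (log_exp_primitive N) t (ln t * exp_quot N (t - 1)).
Proof.
intros Ht.
assert (Hsub : is_derive (fun u => u - 1) t 1) by (auto_derive; [exact I | ring]).
evar_last.
- apply (is_derive_minus (V := R_NormedModule) (fun t => log_exp_coeff N (t - 1) * ln t) (fun t => log_exp_rest N (t - 1))).
  + apply (is_derive_mult (fun t => log_exp_coeff N (t - 1)) ln).
    * apply (is_derive_comp (V := R_NormedModule) (log_exp_coeff N) (fun u => u - 1)); [apply is_derive_log_exp_coeff | exact Hsub].
    * apply is_derive_ln, Ht.
    * exact Rmult_comm.
  + apply (is_derive_comp (V := R_NormedModule) (log_exp_rest N) (fun u => u - 1)); [ | exact Hsub].
    apply is_derive_log_exp_rest. lra.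
- unfold minus, plus, opp, mult, scal; simpl; unfold mult; simpl.
  replace (t - 1 + 1) with t by ring. field. lra.
Qed.

(** * The integrand of K on the real axis *)

Definition kurepa_density (x t : R) : R := exp (- t) * ((exp (x * ln t) - 1) / (t - 1)).

Lemma continuous_kurepa_density (x t : R) : 0 < t -> t <> 1 -> continuous (kurepa_density x) t.
Proof.
intros Ht H1. apply (ex_derive_continuous (V := R_NormedModule)). unfold kurepa_density.
auto_derive. repeat split; lra.
Qed.

(** The secant slope (e^(pu) - 1)/p is nondecreasing in p. With m = e^(pu), the
tangent bounds e^((q-p)u) >= 1 + (q-p)u and 1 >= m (1 - pu) suffice. *)
Lemma exp_secant_le (p q u : R) :
  0 <= p <= q -> q * (exp (p * u) - 1) <= p * (exp (q * u) - 1).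
Proof.
intros Hpq.
assert (E : exp (q * u) = exp (p * u) * exp ((q - p) * u)) by (rewrite <- exp_plus; f_equal; ring).
pose proof (exp_pos (p * u)) as Hm. pose proof (exp_ineq1_le ((q - p) * u)) as H1.
pose proof (exp_ineq1_le (- (p * u))) as H2. rewrite exp_Ropp in H2.
set (m := exp (p * u)) in *. set (w := exp ((q - p) * u)) in *. rewrite E.
assert (H3 : m * (1 - p * u) <= 1).
{ replace 1 with (m * / m) at 2 by (field; lra). apply Rmult_le_compat_l; lra. }
assert (H4 : m * (1 + (q - p) * u) <= m * w) by (apply Rmult_le_compat_l; lra).
assert (0 <= (q - p) * (p * u * m - (m - 1))) by (apply Rmult_le_pos; lra).
nra.
Qed.

Lemma exp_sub_one_sub_bound (v M : R) :
  exp v <= M -> 1 <= M -> 0 <= exp v - 1 - v <= M * (v * v).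
Proof.
intros HM H1. pose proof (exp_ineq1_le v). split; [lra | ].
pose proof (exp_ineq1_le (- v)) as H2. rewrite exp_Ropp in H2.
pose proof (exp_pos v) as Hp. set (m := exp v) in *.
assert (H3 : m * (1 - v) <= 1).
{ replace 1 with (m * / m) at 2 by (field; lra). apply Rmult_le_compat_l; lra. }
destruct (Rle_or_lt 0 v); nra.
Qed.

(** With q = t^(1/4), use -ln t = -4 ln q <= 4 (1 - q)/q; the square of 1/q is
1/sqrt t. *)
Lemma log_sq_quotient_bound (t : R) : 0 < t < 1 -> ln t * ln t / (1 - t) <= 16 / sqrt t.
Proof.
intros Ht. assert (Hs : 0 < sqrt t) by (apply sqrt_lt_R0; lra).
set (r := sqrt t) in *. assert (Er : t = r * r) by (symmetry; apply sqrt_sqrt; lra).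
assert (Hq : 0 < sqrt r) by (apply sqrt_lt_R0; lra).
set (q := sqrt r) in *. assert (Eq : r = q * q) by (symmetry; apply sqrt_sqrt; lra).
assert (El : ln t = 4 * ln q) by (rewrite Er, Eq, !ln_mult by nra; ring).
pose proof (ln_le_sub_one q Hq). pose proof (one_sub_inv_le_ln q Hq).
assert (r < 1) by (apply Rnot_le_lt; intros Hc; nra).
assert (q < 1) by (apply Rnot_le_lt; intros Hc; nra).
assert (Hqi : q * / q = 1) by (field; lra). 
assert (Hl : 0 <= - ln q <= (1 - q) * / q) by lra.
apply Rle_div_l; [lra | ]. rewrite El.
assert (Hl2 : (- ln q) * (- ln q) <= ((1 - q) * / q) * ((1 - q) * / q)) by (apply Rmult_le_compat; lra).
replace (16 / r * (1 - t)) with (16 * (/ q * / q) * (1 - t)) by (rewrite Eq; field; lra).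
assert (0 <= / q * / q) by nra.
assert ((1 - q) * (1 - q) <= 1 - t) by (rewrite Er, Eq; nra).
assert ((/ q * / q) * ((1 - q) * (1 - q)) <= (/ q * / q) * (1 - t)) by (apply Rmult_le_compat_l; lra).
nra.
Qed.

(** With u = ln t, the difference is e^(-t) (e^(yu) - 1 - yu)/(y (t-1)), and
e^(yu) - 1 - yu is of order (yu)^2. What remains is y u^2/|t-1|, times
t^y <= t when t > 1. Crude constants are enough, as y will tend to 0. *)
Lemma kurepa_density_approx (y t : R) :
  0 < y <= 1 -> 0 < t <= 32 -> t <> 1 ->
  Rabs (kurepa_density y t / y - exp (- t) * (ln t / (t - 1))) <= 2048 * y / sqrt t.
Proof.
intros Hy Ht H1.
pose proof (sqrt_lt_R0 t ltac:(lra)) as Hs.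
assert (He : 0 < exp (- t) <= 1).
{ split; [apply exp_pos | ]. rewrite <- exp_0. apply Rlt_le, exp_increasing; lra. }
replace (kurepa_density y t / y - exp (- t) * (ln t / (t - 1)))
  with (exp (- t) * ((exp (y * ln t) - 1 - y * ln t) / y / (t - 1)))
  by (unfold kurepa_density; field; lra).
rewrite Rabs_mult, (Rabs_pos_eq (exp (- t))) by lra.
enough (Hm : Rabs ((exp (y * ln t) - 1 - y * ln t) / y / (t - 1)) <= 2048 * y / sqrt t).
{ pose proof (Rabs_pos ((exp (y * ln t) - 1 - y * ln t) / y / (t - 1))). nra. }
destruct (Rlt_or_le t 1) as [Hc | Hc].
- assert (Hl : ln t < 0) by (rewrite <- ln_1; apply ln_increasing; lra).
  assert (HM : exp (y * ln t) <= 1).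
  { rewrite <- exp_0. apply Rlt_le, exp_increasing. nra. }
  pose proof (exp_sub_one_sub_bound (y * ln t) 1 HM ltac:(lra)) as Hb.
  rewrite Rabs_left1.
  + replace (- ((exp (y * ln t) - 1 - y * ln t) / y / (t - 1)))
      with ((exp (y * ln t) - 1 - y * ln t) / (y * (1 - t))) by (field; lra).
    apply Rle_div_l; [nra | ].
    pose proof (log_sq_quotient_bound t ltac:(lra)) as Hq. apply (Rle_div_l _ _ (1 - t) ltac:(lra)) in Hq.
    replace (2048 * y / sqrt t * (y * (1 - t))) with (128 * (y * y) * (16 / sqrt t * (1 - t))) by (field; lra).
    assert (0 <= y * y) by nra. assert (0 <= ln t * ln t) by nra.
    assert ((y * y) * (ln t * ln t) <= (y * y) * (16 / sqrt t * (1 - t))) by (apply Rmult_le_compat_l; lra).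
    assert (0 <= (y * y) * (ln t * ln t)) by (apply Rmult_le_pos; lra).
    lra.
  + replace ((exp (y * ln t) - 1 - y * ln t) / y / (t - 1))
      with (- ((exp (y * ln t) - 1 - y * ln t) / (y * (1 - t)))) by (field; lra).
    apply Ropp_le_cancel. rewrite Ropp_involutive, Ropp_0. apply Rdiv_le_0_compat; nra.
- assert (Hc' : 0 < t - 1) by lra.
  assert (Hl : 0 < ln t) by (rewrite <- ln_1; apply ln_increasing; lra).
  assert (HM : exp (y * ln t) <= t).
  { rewrite <- (exp_ln t) at 2 by lra. assert (Hle : y * ln t <= ln t) by nra.
    destruct (Rle_lt_or_eq_dec _ _ Hle) as [Hlt | ->]; [now apply Rlt_le, exp_increasing | lra]. }
  pose proof (exp_sub_one_sub_bound (y * ln t) t HM ltac:(lra)) as Hb.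
  assert (Hp : 0 <= (exp (y * ln t) - 1 - y * ln t) / y / (t - 1)).
  { apply Rdiv_le_0_compat; [apply Rdiv_le_0_compat; lra | lra]. }
  rewrite Rabs_pos_eq by exact Hp.
  pose proof (log_quotient_bounds t ltac:(lra) H1) as [Hq0 Hq].
  pose proof (ln_le_sub_one t ltac:(lra)).
  replace ((exp (y * ln t) - 1 - y * ln t) / y / (t - 1))
    with ((exp (y * ln t) - 1 - y * ln t) / (y * (t - 1))) by (field; lra).
  apply Rle_div_l; [nra | ].
  apply (Rle_div_l _ _ (t - 1) ltac:(lra)) in Hq.
  replace (2048 * y / sqrt t * (y * (t - 1))) with ((y * y) * (1024 * (2 / sqrt t * (t - 1)))) by (field; lra).
  replace (t * (y * ln t * (y * ln t))) with ((y * y) * (t * ln t * ln t)) in Hb by ring.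
  apply Rle_trans with (1 := proj2 Hb). apply Rmult_le_compat_l; [nra | ].
  apply Rle_trans with (1024 * ln t); [ | lra].
  apply Rmult_le_compat_r; [lra | ]. nra.
Qed.

(** * Evaluating the integral over [0, 32] *)

(** The zero of the polynomial at 0 tames the logarithm: it turns a product with
ln v into a continuous function times v ln v. *)
Lemma log_poly_factor (N : nat) :
  exists q : R -> R, (forall v, continuous q v) /\ forall v, log_poly N v = v * q v.
Proof.
induction N as [ | N [q [Hc Hq]]].
- exists (fun _ => 0). split; [intros v; apply continuous_const | intros v; simpl; ring].
- exists (fun v => q v + v ^ N / INR (S N)). split.
  + intros v. apply (continuous_plus q (fun v => v ^ N / INR (S N))); [apply Hc | ].
    apply (ex_derive_continuous (V := R_NormedModule)). 
    pose proof (lt_0_INR (S N) ltac:(lia)). auto_derive. lra.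
  + intros v. change (log_poly N v + v ^ S N / INR (S N) = v * (q v + v ^ N / INR (S N))).
    rewrite Hq, <- (tech_pow_Rmult v N). pose proof (lt_0_INR (S N) ltac:(lia)). field. lra.
Qed.

Lemma continuous_alt_geo (n : nat) (s : R) : continuous (alt_geo n) s.
Proof.
induction n as [ | n IH]; [apply continuous_const | ].
apply (continuous_minus (fun s => s ^ n) (alt_geo n)); [ | exact IH].
apply (ex_derive_continuous (V := R_NormedModule)). auto_derive. exact I.
Qed.

Lemma log_exp_coeff_factor (N : nat) :
  exists q : R -> R, (forall s, continuous q s) /\ forall s, log_exp_coeff N s = (s + 1) * q s.
Proof.
induction N as [ | N [q [Hc Hq]]].
- exists (fun _ => 0). split; [intros v; apply continuous_const | intros v; simpl; ring].
- exists (fun s => q s + (-1) ^ S N / INR (fact (S N)) / INR (S N) * alt_geo (S N) s). split.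
  + intros s. apply (continuous_plus q); [apply Hc | ].
    apply (continuous_scal_r (V := R_NormedModule) _ (alt_geo (S N))), continuous_alt_geo.
  + intros s. cbn [log_exp_coeff]. rewrite Hq, <- alt_geo_mul. ring.
Qed.

Lemma continuous_log_exp_primitive (N : nat) (t : R) : 0 <= t -> continuous (log_exp_primitive N) t.
Proof.
intros Ht. destruct (Rle_lt_or_eq_dec 0 t Ht) as [Hp | <-].
{ apply (ex_derive_continuous (V := R_NormedModule)). eexists. now apply is_derive_log_exp_primitive. }
destruct (log_exp_coeff_factor N) as [q [Hc Hq]].
assert (Hsub : forall t, continuous (fun u => u - 1) t).
{ intros u. apply (ex_derive_continuous (V := R_NormedModule)). auto_derive. exact I. }
apply (continuous_minus (fun t => log_exp_coeff N (t - 1) * ln t) (fun t => log_exp_rest N (t - 1))).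
- apply (continuous_ext (fun t => q (t - 1) * (t * ln t))).
  + intros u. rewrite Hq. change (q (u - 1) * (u * ln u) = (u - 1 + 1) * q (u - 1) * ln u). ring.
  + apply (continuous_mult (fun t => q (t - 1))); [ | apply continuous_mul_ln; lra].
    apply (continuous_comp (fun u => u - 1) q); [apply Hsub | apply Hc].
- apply (continuous_comp (fun u => u - 1) (log_exp_rest N)); [apply Hsub | ].
  clear. induction N as [ | N IH]; [apply continuous_const | ].
  apply (continuous_plus (log_exp_rest N)); [exact IH | ].
  apply (continuous_scal_r (V := R_NormedModule) _ (alt_log (S N))).
  apply (ex_derive_continuous (V := R_NormedModule)). eexists. apply is_derive_alt_log.
Qed.

Lemma exp_le_3_of_le_1 (x : R) : x <= 1 -> exp x <= 3.
Proof.
intros Hx. apply Rle_trans with (2 := exp_le_3).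
destruct (Rle_lt_or_eq_dec x 1 Hx) as [Hlt | ->]; [apply Rlt_le, exp_increasing, Hlt | lra].
Qed.

Definition exp_poly_tol (N : nat) : R := 3 * 31 ^ N / INR (fact N).

Lemma exp_neg_poly_error (N : nat) (s : R) :
  -1 <= s <= 31 -> Rabs (exp (- s) - exp_poly N (- s)) <= exp_poly_tol N.
Proof.
intros Hs. pose proof (INR_fact_lt_0 N).
assert (Hm : forall x, 0 <= x <= 31 -> 3 * x ^ N / INR (fact N) <= exp_poly_tol N).
{ intros x Hx. unfold exp_poly_tol, Rdiv. apply Rmult_le_compat_r; [apply Rlt_le, Rinv_0_lt_compat; lra | ].
  apply Rmult_le_compat_l; [lra | ]. apply pow_incr. lra. }
destruct (Rle_or_lt 0 s) as [Hc | Hc].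
- apply Rle_trans with (3 * s ^ N / INR (fact N)); [ | apply Hm; lra].
  replace (- s) with (-1 * s) by ring.
  apply (exp_poly_error (-1) 31 3 N); [rewrite Rabs_left; lra | | lra].
  intros x Hx. apply exp_le_3_of_le_1. lra.
- apply Rle_trans with (3 * (- s) ^ N / INR (fact N)); [ | apply Hm; lra].
  replace (exp (- s)) with (exp (1 * (- s))) by (f_equal; ring).
  replace (exp_poly N (- s)) with (exp_poly N (1 * (- s))) by (f_equal; ring).
  apply (exp_poly_error 1 1 3 N); [apply Rabs_R1 | | lra].
  intros x Hx. apply exp_le_3_of_le_1. lra.
Qed.

(** The difference of the integrands has three sources: replacing (t^y - 1)/y by
ln t, replacing e^(-(t-1)) by its Taylor polynomial, and replacing
ln t/(t-1) by the derivative of G. The point 1, where the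
integrand is discontinuous, is kept out of the open interval. *)
Lemma kurepa_integral_piece (N : nat) (y delta : R) (G : R -> R) (a b I : R) :
  0 < y <= 1 -> 0 <= a -> a <= b <= 32 -> b <= 1 \/ 1 <= a ->
  is_RInt (kurepa_density y) a b I ->
  (forall t, a <= t <= b -> continuous G t) ->
  (forall t, a < t < b ->
    exists l : R, is_derive G t l /\ Rabs (ln t / (t - 1) - l) <= delta / sqrt t) ->
  Rabs (exp 1 * (I / y) - ((G b + log_exp_primitive N b) - (G a + log_exp_primitive N a)))
  <= 2 * (6144 * y + 2 * exp_poly_tol (S N) + delta) * (sqrt b - sqrt a).
Proof.
intros Hy Ha Hab Hout HI HGc HGd.
pose proof exp_le_3 as He3. pose proof (exp_pos 1) as He0.
apply (RInt_close_primitive (fun t => exp 1 / y * kurepa_density y t) (fun t => G t + log_exp_primitive N t)); try lra.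
- replace (exp 1 * (I / y)) with (exp 1 / y * I) by (field; lra).
  apply (is_RInt_scal (V := R_NormedModule)), HI.
- intros t Ht. apply (continuous_mult (fun _ => exp 1 / y)); [apply continuous_const | ].
  apply continuous_kurepa_density; lra.
- intros t Ht. apply (continuous_plus G (log_exp_primitive N)); [now apply HGc | apply continuous_log_exp_primitive; lra].
- intros t Ht. destruct (HGd t Ht) as [l [Hl Hb]].
  exists (l + ln t * exp_quot N (t - 1)). split.
  { apply (is_derive_plus (V := R_NormedModule) G (log_exp_primitive N)); [exact Hl | apply is_derive_log_exp_primitive; lra]. }
  assert (Ht1 : t <> 1) by lra. assert (Ht0 : 0 < t) by lra.
  pose proof (sqrt_lt_R0 t Ht0) as Hs.
  pose proof (kurepa_density_approx y t Hy ltac:(lra) Ht1) as H1.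
  pose proof (log_quotient_bounds t Ht0 Ht1) as [H2 H3].
  pose proof (exp_neg_poly_error (S N) (t - 1) ltac:(lra)) as H4.
  set (w := ln t / (t - 1)) in *.
  assert (E : exp 1 / y * kurepa_density y t - (l + ln t * exp_quot N (t - 1)) =
    exp 1 * (kurepa_density y t / y - exp (- t) * w)
    + w * (exp (- (t - 1)) - exp_poly (S N) (- (t - 1))) + (w - l)).
  { rewrite <- exp_quot_spec.
    replace (exp (- (t - 1))) with (exp 1 * exp (- t)) by (rewrite <- exp_plus; f_equal; ring).
    unfold w. field. lra. }
  rewrite E.
  replace ((6144 * y + 2 * exp_poly_tol (S N) + delta) / sqrt t)
    with (3 * (2048 * y / sqrt t) + 2 / sqrt t * exp_poly_tol (S N) + delta / sqrt t) by (field; lra).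
  eapply Rle_trans; [apply Rabs_triang | ]. apply Rplus_le_compat; [ | exact Hb].
  eapply Rle_trans; [apply Rabs_triang | ]. apply Rplus_le_compat.
  + rewrite Rabs_mult, (Rabs_pos_eq (exp 1)) by lra. apply Rmult_le_compat; try lra. apply Rabs_pos.
  + rewrite Rabs_mult, (Rabs_pos_eq w) by lra. apply Rmult_le_compat; try lra. apply Rabs_pos.
Qed.

(** Up to a constant -Li2(1-t) is Li2(t) + ln t ln(1-t). Truncating Li2(t) and
ln(1-t) at the same order makes the two new logarithmic errors cancel, leaving
only the factor 1 - t^M in the derivative. *)
Lemma log_quotient_primitive_near_0 (M : nat) (t : R) : 0 < t <= 1 / 2 ->
  exists l : R, is_derive (fun u => dilog_poly M u - ln u * log_poly M u) t l /\
   Rabs (ln t / (t - 1) - l) <= 2 * (1 / 2) ^ M / sqrt t.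
Proof.
intros Ht. pose proof (sqrt_lt_R0 t ltac:(lra)) as Hs.
exists (ln t / (t - 1) * (1 - t ^ M)). split.
- evar_last.
  + apply (is_derive_minus (V := R_NormedModule) (dilog_poly M) (fun u => ln u * log_poly M u)).
    * apply is_derive_dilog_poly; lra.
    * apply (is_derive_mult ln (log_poly M)); [apply is_derive_ln; lra | apply is_derive_log_poly; lra | exact Rmult_comm].
  + unfold minus, plus, opp, mult; simpl. field. lra.
- pose proof (log_quotient_bounds t ltac:(lra) ltac:(lra)) as [H2 H3].
  assert (Hp : 0 <= t ^ M <= (1 / 2) ^ M) by (split; [apply pow_le; lra | apply pow_incr; lra]).
  set (w := ln t / (t - 1)) in *.
  replace (w - w * (1 - t ^ M)) with (w * t ^ M) by ring.
  rewrite Rabs_pos_eq by (apply Rmult_le_pos; lra).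
  replace (2 * (1 / 2) ^ M / sqrt t) with (2 / sqrt t * (1 / 2) ^ M) by (field; lra).
  apply Rmult_le_compat; lra.
Qed.

(** Here the primitive is -Li2(1-t). *)
Lemma log_quotient_primitive_below_1 (M : nat) (t : R) : 1 / 2 <= t < 1 ->
  exists l : R, is_derive (fun u => - dilog_poly M (1 - u)) t l /\
   Rabs (ln t / (t - 1) - l) <= 2 * (1 / 2) ^ M / sqrt t.
Proof.
intros Ht. pose proof (sqrt_lt_R0 t ltac:(lra)) as Hs.
exists (log_poly M (1 - t) / (1 - t)). split.
- evar_last.
  + apply (is_derive_opp (V := R_NormedModule) (fun u => dilog_poly M (1 - u))).
    apply (is_derive_comp (V := R_NormedModule) (dilog_poly M) (fun u => 1 - u)).
    * apply is_derive_dilog_poly; lra.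
    * instantiate (1 := -1). auto_derive; [exact I | ring].
  + change (- (-1 * (log_poly M (1 - t) / (1 - t))) = log_poly M (1 - t) / (1 - t)). ring.
- pose proof (log_poly_error M (1 - t) ltac:(lra)) as He.
  replace (1 - (1 - t)) with t in He by ring.
  replace (ln t / (t - 1) - log_poly M (1 - t) / (1 - t))
    with ((- ln t - log_poly M (1 - t)) / (1 - t)) by (field; lra).
  rewrite Rabs_pos_eq by (apply Rdiv_le_0_compat; lra).
  assert (Hs1 : sqrt t <= 1) by (rewrite <- sqrt_1; apply sqrt_le_1_alt; lra).
  pose proof (pow_le (1 / 2) M ltac:(lra)).
  apply Rle_trans with (2 * (1 / 2) ^ M).
  + apply Rle_div_l; lra.
  + apply (proj1 (Rle_div_r _ _ _ Hs)). nra.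
Qed.

Lemma sqrt_le_self (t : R) : 1 <= t -> sqrt t <= t.
Proof. intros Ht. pose proof (sqrt_sqrt t ltac:(lra)). pose proof (sqrt_pos t).
 apply Rnot_lt_le. intros Hc. nra. Qed.

(** By Landen's identity -Li2(1-t) = (ln t)^2/2 + Li2(1 - 1/t), whose argument stays
in [0, 1/2] up to t = 2. *)
Lemma log_quotient_primitive_above_1 (M : nat) (t : R) : 1 < t <= 2 ->
  exists l : R, is_derive (fun u => ln u * ln u / 2 + dilog_poly M (1 - / u)) t l /\
   Rabs (ln t / (t - 1) - l) <= 2 * (1 / 2) ^ M / sqrt t.
Proof.
intros Ht. pose proof (sqrt_lt_R0 t ltac:(lra)) as Hs.
assert (Hv : 0 < 1 - / t <= 1 / 2).
{ assert (t * / t = 1) by (field; lra). assert (0 < / t) by (apply Rinv_0_lt_compat; lra). split; nra. }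
exists (ln t / t + log_poly M (1 - / t) / (t * (t - 1))). split.
- evar_last.
  + apply (is_derive_plus (V := R_NormedModule) (fun u => ln u * ln u / 2) (fun u => dilog_poly M (1 - / u))).
    * instantiate (1 := ln t / t). auto_derive; [lra | field; lra].
    * apply (is_derive_comp (V := R_NormedModule) (dilog_poly M) (fun u => 1 - / u)).
      -- apply is_derive_dilog_poly; lra.
      -- instantiate (1 := / (t * t)). auto_derive; [lra | field; lra].
  + change (ln t / t + / (t * t) * (log_poly M (1 - / t) / (1 - / t)) = ln t / t + log_poly M (1 - / t) / (t * (t - 1))).
    field. lra.
- pose proof (log_poly_error M (1 - / t) ltac:(lra)) as He.
  replace (1 - (1 - / t)) with (/ t) in He by ring. rewrite ln_Rinv, Ropp_involutive in He by lra.
  replace (ln t / (t - 1) - (ln t / t + log_poly M (1 - / t) / (t * (t - 1))))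
    with ((ln t - log_poly M (1 - / t)) / (t * (t - 1))) by (field; lra).
  rewrite Rabs_pos_eq by (apply Rdiv_le_0_compat; nra).
  pose proof (sqrt_le_self t ltac:(lra)).
  pose proof (pow_le (1 / 2) M ltac:(lra)).
  apply Rle_div_l; [nra | ]. apply Rle_trans with (1 := proj2 He).
  replace (2 * (1 / 2) ^ M / sqrt t * (t * (t - 1))) with (2 * (1 / 2) ^ M * (t * t / sqrt t * (1 - / t))) by (field; lra).
  apply Rmult_le_compat_l; [lra | ].
  rewrite <- (Rmult_1_l (1 - / t)) at 1. apply Rmult_le_compat_r; [lra | ].
  apply (proj1 (Rle_div_r _ _ _ Hs)). nra.
Qed.

(** The reflection formula turns Li2(1 - 1/t) into
-Li2(1/t) - ln(1/t) ln(1 - 1/t) up to a constant; as near 0, a common truncation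
order leaves only a factor in the derivative. *)
Lemma log_quotient_primitive_large (M : nat) (t : R) : 2 <= t ->
  exists l : R, is_derive (fun u => ln u * ln u / 2 - ln u * log_poly M (/ u) - dilog_poly M (/ u)) t l /\
   Rabs (ln t / (t - 1) - l) <= 2 * (1 / 2) ^ M / sqrt t.
Proof.
intros Ht. pose proof (sqrt_lt_R0 t ltac:(lra)) as Hs.
assert (Hv : 0 < / t <= 1 / 2).
{ assert (t * / t = 1) by (field; lra). assert (0 < / t) by (apply Rinv_0_lt_compat; lra). split; nra. }
assert (Hi : is_derive (fun u => / u) t (- / (t * t))) by (auto_derive; [lra | field; lra]).
exists (ln t / (t - 1) * (1 - / t * (/ t) ^ M)). split.
- evar_last.
  + apply (is_derive_minus (V := R_NormedModule) (fun u => ln u * ln u / 2 - ln u * log_poly M (/ u)) (fun u => dilog_poly M (/ u))).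
    * apply (is_derive_minus (V := R_NormedModule) (fun u => ln u * ln u / 2) (fun u => ln u * log_poly M (/ u))).
      -- instantiate (1 := ln t / t). auto_derive; [lra | field; lra].
      -- apply (is_derive_mult ln (fun u => log_poly M (/ u))); [apply is_derive_ln; lra | | exact Rmult_comm].
         apply (is_derive_comp (V := R_NormedModule) (log_poly M) (fun u => / u)); [ | exact Hi].
         apply is_derive_log_poly; lra.
    * apply (is_derive_comp (V := R_NormedModule) (dilog_poly M) (fun u => / u)); [ | exact Hi].
      apply is_derive_dilog_poly; lra.
  + unfold minus, plus, opp, mult, scal; simpl; unfold mult; simpl.
    generalize (log_poly M (/ t)) ((/ t) ^ M). intros L P. field. lra.
- pose proof (log_quotient_bounds t ltac:(lra) ltac:(lra)) as [H2 H3].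
  assert (Hp : 0 <= (/ t) ^ M <= (1 / 2) ^ M) by (split; [apply pow_le; lra | apply pow_incr; lra]).
  set (w := ln t / (t - 1)) in *.
  replace (w - w * (1 - / t * (/ t) ^ M)) with (w * (/ t * (/ t) ^ M)) by ring.
  assert (0 <= / t * (/ t) ^ M <= (1 / 2) ^ M) by nra.
  rewrite Rabs_pos_eq by (apply Rmult_le_pos; lra).
  replace (2 * (1 / 2) ^ M / sqrt t) with (2 / sqrt t * (1 / 2) ^ M) by (field; lra).
  apply Rmult_le_compat; lra.
Qed.

(** The increments over the four intervals, added up; each of them contributes one
dilogarithm at 1/2. *)
Definition slope_approx (N M : nat) : R :=
  4 * dilog_poly M (1 / 2) - dilog_poly M (1 / 32)
  + ln 2 * (2 * log_poly M (1 / 2) - 5 * log_poly M (1 / 32) + 5 * log_exp_coeff N 31)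
  + 25 / 2 * (ln 2 * ln 2) - (log_exp_rest N 31 - log_exp_rest N (-1)).

Lemma continuous_comp_one_sub (p : R -> R) (t : R) :
  (forall v, continuous p v) -> continuous (fun u => p (1 - u)) t.
Proof.
intros Hp. apply (continuous_comp (fun u => 1 - u) p); [ | apply Hp].
apply (ex_derive_continuous (V := R_NormedModule)). auto_derive. exact I.
Qed.

Lemma continuous_comp_inv (p : R -> R) (t : R) :
  0 < t -> (forall v, continuous p v) -> continuous (fun u => p (/ u)) t.
Proof.
intros Ht Hp. apply (continuous_comp (fun u => / u) p); [ | apply Hp].
apply (ex_derive_continuous (V := R_NormedModule)). auto_derive. lra.
Qed.

Lemma continuous_ln_sq_half (t : R) : 0 < t -> continuous (fun u => ln u * ln u / 2) t.
Proof. intros Ht. apply (ex_derive_continuous (V := R_NormedModule)). auto_derive. lra. Qed.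

Lemma kurepa_integral_0_32 (N M : nat) (y I : R) :
  0 < y <= 1 -> is_RInt (kurepa_density y) 0 32 I ->
  Rabs (exp 1 * (I / y) - slope_approx N M)
    <= 12 * (6144 * y + 2 * exp_poly_tol (S N) + 2 * (1 / 2) ^ M).
Proof.
intros Hy HI.
destruct (RInt_split _ 0 2 32 I ltac:(lra) HI) as (I123 & I4 & H123 & H4 & E4).
destruct (RInt_split _ 0 1 2 I123 ltac:(lra) H123) as (I12 & I3 & H12 & H3 & E3).
destruct (RInt_split _ 0 (1 / 2) 1 I12 ltac:(lra) H12) as (I1 & I2 & H1 & H2 & E2).
assert (E : I = I1 + I2 + I3 + I4) by lra.
set (p := (1 / 2) ^ M).
(* B1 to B4 are the four increments; their error terms telescope to sqrt 32. *)
pose proof (kurepa_integral_piece N y (2 * p) (fun u => dilog_poly M u - ln u * log_poly M u) 0 (1 / 2) I1 Hy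
  ltac:(lra) ltac:(lra) ltac:(lra) H1) as B1.
pose proof (kurepa_integral_piece N y (2 * p) (fun u => - dilog_poly M (1 - u)) (1 / 2) 1 I2 Hy
  ltac:(lra) ltac:(lra) ltac:(lra) H2) as B2.
pose proof (kurepa_integral_piece N y (2 * p) (fun u => ln u * ln u / 2 + dilog_poly M (1 - / u)) 1 2 I3 Hy
  ltac:(lra) ltac:(lra) ltac:(lra) H3) as B3.
pose proof (kurepa_integral_piece N y (2 * p) (fun u => ln u * ln u / 2 - ln u * log_poly M (/ u) - dilog_poly M (/ u)) 2 32 I4 Hy
  ltac:(lra) ltac:(lra) ltac:(lra) H4) as B4.
specialize (B1 ltac:(
  intros t Ht; destruct (log_poly_factor M) as [q [Hc Hq]];
  apply (continuous_minus (dilog_poly M) (fun u => ln u * log_poly M u));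
  [ apply continuous_dilog_poly
  | apply (continuous_ext (fun u => q u * (u * ln u)));
    [ intros u; rewrite Hq; change (q u * (u * ln u) = ln u * (u * q u)); ring
    | apply (continuous_mult q); [apply Hc | apply continuous_mul_ln; lra] ] ])
  ltac:(intros t Ht; apply log_quotient_primitive_near_0; lra)).
specialize (B2 ltac:(
  intros t Ht; apply (continuous_opp (V := R_NormedModule) (fun u => dilog_poly M (1 - u)));
  apply continuous_comp_one_sub, continuous_dilog_poly)
  ltac:(intros t Ht; apply log_quotient_primitive_below_1; lra)).
specialize (B3 ltac:(
  intros t Ht; apply (continuous_plus (fun u => ln u * ln u / 2) (fun u => dilog_poly M (1 - / u)));
  [ apply continuous_ln_sq_half; lra
  | apply (continuous_comp_inv (fun v => dilog_poly M (1 - v))); [lra | intros v];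
    apply continuous_comp_one_sub, continuous_dilog_poly ])
  ltac:(intros t Ht; apply log_quotient_primitive_above_1; lra)).
specialize (B4 ltac:(
  intros t Ht;
  apply (continuous_minus (fun u => ln u * ln u / 2 - ln u * log_poly M (/ u)) (fun u => dilog_poly M (/ u)));
  [ apply (continuous_minus (fun u => ln u * ln u / 2) (fun u => ln u * log_poly M (/ u)));
    [ apply continuous_ln_sq_half; lra
    | apply (continuous_mult ln (fun u => log_poly M (/ u)));
      [ apply (ex_derive_continuous (V := R_NormedModule)); auto_derive; lra
      | apply continuous_comp_inv; [lra | apply continuous_log_poly] ] ]
  | apply continuous_comp_inv; [lra | apply continuous_dilog_poly] ])
  ltac:(intros t Ht; apply log_quotient_primitive_large; lra)).
set (eta := 6144 * y + 2 * exp_poly_tol (S N) + 2 * p) in *.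
assert (L12 : ln (1 / 2) = - ln 2) by (replace (1 / 2) with (/ 2) by lra; apply ln_Rinv; lra).
assert (L32 : ln 32 = 5 * ln 2) by (replace 32 with (2 ^ 5) by ring; rewrite ln_pow by lra; simpl; ring).
assert (Hmom : log_exp_primitive N 32 - log_exp_primitive N 0 = log_exp_coeff N 31 * (5 * ln 2) - (log_exp_rest N 31 - log_exp_rest N (-1))).
{ unfold log_exp_primitive. replace (32 - 1) with 31 by ring. replace (0 - 1) with (-1) by ring. rewrite L32.
  destruct (log_exp_coeff_factor N) as [q [_ Hq]]. rewrite (Hq (-1)). ring. }
cbv beta in B1, B2, B3, B4.
rewrite log_poly_0, dilog_poly_0, L12 in B1.
replace (1 - 1) with 0 in B2 by ring. replace (1 - 1 / 2) with (1 / 2) in B2 by lra. rewrite dilog_poly_0 in B2.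
replace (1 - / 2) with (1 / 2) in B3 by lra. replace (1 - / 1) with 0 in B3 by (rewrite Rinv_1; ring).
rewrite dilog_poly_0, ln_1 in B3.
replace (/ 32) with (1 / 32) in B4 by lra. replace (/ 2) with (1 / 2) in B4 by lra. rewrite L32 in B4.
rewrite sqrt_0 in B1.
assert (Heta : 0 <= eta).
{ assert (0 <= 2 * eta * (sqrt (1 / 2) - 0)) by (eapply Rle_trans; [apply Rabs_pos | exact B1]).
  pose proof (sqrt_lt_R0 (1 / 2) ltac:(lra)). apply Rnot_lt_le. intros Hc. nra. }
assert (Hs : sqrt 32 <= 6).
{ rewrite <- (sqrt_Rsqr 6) by lra. apply sqrt_le_1_alt. unfold Rsqr. lra. }
apply Rabs_le_between in B1. apply Rabs_le_between in B2. apply Rabs_le_between in B3. apply Rabs_le_between in B4.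
assert (HE : exp 1 * (I / y) = exp 1 * (I1 / y) + exp 1 * (I2 / y) + exp 1 * (I3 / y) + exp 1 * (I4 / y))
  by (rewrite E; field; lra).
assert (Hfin : 2 * eta * sqrt 32 <= 12 * eta) by nra.
unfold slope_approx. rewrite HE. apply Rabs_le. 
set (a1 := exp 1 * (I1 / y)) in *. set (a2 := exp 1 * (I2 / y)) in *.
set (a3 := exp 1 * (I3 / y)) in *. set (a4 := exp 1 * (I4 / y)) in *.
split; lra.
Qed.

(** The secant inequality gives t^y - 1 <= y (t - 1). *)
Lemma kurepa_density_tail (y t : R) :
  0 < y <= 1 -> 1 < t -> 0 <= kurepa_density y t <= y * exp (- t).
Proof.
intros Hy Ht. unfold kurepa_density.
pose proof (exp_pos (- t)) as He.
assert (Hl : 0 < ln t) by (rewrite <- ln_1; apply ln_increasing; lra).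
assert (H1 : exp (y * ln t) - 1 <= y * (t - 1)).
{ pose proof (exp_secant_le y 1 (ln t) ltac:(lra)) as H. rewrite !Rmult_1_l, exp_ln in H by lra. exact H. }
assert (H0 : 0 <= exp (y * ln t) - 1).
{ pose proof (exp_ineq1_le (y * ln t)). nra. }
assert (H2 : 0 <= (exp (y * ln t) - 1) / (t - 1) <= y).
{ split; [apply Rdiv_le_0_compat; lra | apply Rle_div_l; lra]. }
nra.
Qed.

Lemma kurepa_integral_tail (y b J : R) :
  0 < y <= 1 -> 32 <= b -> is_RInt (kurepa_density y) 32 b J -> 0 <= J <= y * exp (-32).
Proof.
intros Hy Hb HJ. split.
- assert (H0 : is_RInt (fun _ => 0) 32 b 0).
  { evar_last; [apply (is_RInt_const (V := R_NormedModule)) | apply (scal_zero_r (V := R_NormedModule))]. }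
  apply (is_RInt_le _ _ _ _ _ _ Hb H0 HJ). intros t Ht. apply kurepa_density_tail; lra.
- assert (H : J <= - (y * exp (- b)) - - (y * exp (- 32))).
  { apply (RInt_le_primitive (kurepa_density y) (fun t => - (y * exp (- t))) 32 b J Hb HJ).
    - intros t Ht. apply continuous_kurepa_density; lra.
    - intros t Ht. apply (ex_derive_continuous (V := R_NormedModule)). auto_derive. exact I.
    - intros t Ht. exists (y * exp (- t)). split; [auto_derive; [exact I | ring] | ].
      apply kurepa_density_tail; lra. }
  pose proof (exp_pos (- b)). nra.
Qed.

Lemma kurepa_integral_0_b (N M : nat) (y b I : R) :
  0 < y <= 1 -> 32 <= b -> is_RInt (kurepa_density y) 0 b I ->
  Rabs (exp 1 * (I / y) - slope_approx N M)
    <= 12 * (6144 * y + 2 * exp_poly_tol (S N) + 2 * (1 / 2) ^ M) + 3 * exp (- 32).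
Proof.
intros Hy Hb HI.
destruct (RInt_split _ 0 32 b I ltac:(lra) HI) as (I1 & J & H1 & HJ & E).
pose proof (kurepa_integral_0_32 N M y I1 Hy H1) as B1. pose proof (kurepa_integral_tail y b J Hy Hb HJ) as BJ.
assert (HJy : 0 <= J / y <= exp (-32)).
{ split; [apply Rdiv_le_0_compat; lra | apply Rle_div_l; lra]. }
replace (exp 1 * (I / y)) with (exp 1 * (I1 / y) + exp 1 * (J / y)) by (rewrite E; field; lra).
pose proof exp_le_3. pose proof (exp_pos 1).
assert (0 <= exp 1 * (J / y) <= 3 * exp (-32)) by nra.
apply Rabs_le_between in B1. apply Rabs_le. lra.
Qed.

(** * Exact evaluation of the rational numbers *)

Record log_exp_sums := LogExpSums {
  z_fact : Z; z_pow : Z; z_sign : Z; z_alt : Z; z_log : Z; z_rest : Z }.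

(** The sums at an integer s, cleared of denominators: with f = n!, the fields hold
f, s^n, (-1)^n, f [alt_log], f^2 [log_exp_coeff] and f^3 [log_exp_rest]. Integers
avoid the costly reduction of fractions to lowest terms. *)
Fixpoint int_log_exp (s : Z) (n : nat) : log_exp_sums :=
  match n with
  | O => LogExpSums 1 1 1 0 0 0
  | S m =>
    let r := int_log_exp s m in
    let k := Z.of_nat (S m) in
    let p := (z_pow r * s)%Z in
    let g := (- z_sign r)%Z in
    let a := (z_fact r * p - k * z_alt r)%Z in
    LogExpSums (k * z_fact r) p g a
      (k * k * z_log r + g * z_fact r * (p - g))
      (k * k * k * z_rest r + g * z_fact r * a)
  end.

Lemma int_log_exp_correct (s : Z) (n : nat) :
  let r := int_log_exp s n in
  let x := IZR s in
  let f := INR (fact n) in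
  IZR (z_fact r) = f /\ IZR (z_pow r) = x ^ n /\ IZR (z_sign r) = (-1) ^ n /\
  IZR (z_alt r) = f * alt_log n x /\ IZR (z_log r) = f * f * log_exp_coeff n x /\
  IZR (z_rest r) = f * f * f * log_exp_rest n x.
Proof.
intros r x f. subst r x f. induction n as [ | n IH].
- simpl. repeat split; ring.
- destruct IH as (Hf & Hp & Hg & Ha & Hl & Hr).
  cbn [int_log_exp z_fact z_pow z_sign z_alt z_log z_rest].
  set (k := Z.of_nat (S n)). assert (Hk : IZR k = INR (S n)) by (symmetry; apply INR_IZR_INZ).
  assert (Hk0 : INR (S n) <> 0) by (apply not_0_INR; lia).
  assert (Hf0 : INR (fact n) <> 0) by (apply Rgt_not_eq, INR_fact_lt_0).
  set (a := (z_fact (int_log_exp s n) * (z_pow (int_log_exp s n) * s) - k * z_alt (int_log_exp s n))%Z).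
  assert (Ef : INR (fact (S n)) = INR (S n) * INR (fact n)) by apply (mult_INR (S n) (fact n)).
  assert (Ha' : IZR a = INR (fact (S n)) * alt_log (S n) (IZR s)).
  { unfold a. rewrite minus_IZR, !mult_IZR, Hf, Hp, Ha, Hk, Ef. cbn [alt_log]. 
    rewrite <- tech_pow_Rmult. field. exact Hk0. }
  rewrite !plus_IZR, !mult_IZR, minus_IZR, Ha', opp_IZR, !mult_IZR, Hf, Hp, Hg, Hl, Hr, Hk, Ef.
  cbn [log_exp_coeff log_exp_rest]. rewrite Ef, <- !tech_pow_Rmult.
  repeat split; field; split; assumption.
Qed.

Record inverse_sums := InverseSums {
  i_fact : Z; i_pow : Z; i_exp : Z; i_log : Z; i_dilog : Z }.

(** The truncated series at 1/d, cleared of denominators in the same way, with the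
additional factor d^n. *)
Fixpoint int_inverse_sums (d : Z) (n : nat) : inverse_sums :=
  match n with
  | O => InverseSums 1 1 0 0 0
  | S m =>
    let r := int_inverse_sums d m in
    let k := Z.of_nat (S m) in
    InverseSums (k * i_fact r) (d * i_pow r) (d * k * (i_exp r + 1))
      (d * k * i_log r + i_fact r) (d * k * k * i_dilog r + i_fact r * i_fact r)
  end.

Lemma int_inverse_sums_correct (d : Z) (n : nat) :
  (0 < d)%Z ->
  let r := int_inverse_sums d n in
  let x := 1 / IZR d in
  let f := INR (fact n) in
  IZR (i_fact r) = f /\ IZR (i_pow r) = IZR d ^ n /\
  IZR (i_exp r) = IZR d ^ n * f * exp_poly n x /\
  IZR (i_log r) = IZR d ^ n * f * log_poly n x /\
  IZR (i_dilog r) = IZR d ^ n * f * f * dilog_poly n x.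
Proof.
intros Hd r x f. subst r x f. apply IZR_lt in Hd. induction n as [ | n IH].
- simpl. repeat split; ring.
- destruct IH as (Hf & Hp & He & Hl & Hr).
  cbn [int_inverse_sums i_fact i_pow i_exp i_log i_dilog].
  set (k := Z.of_nat (S n)). assert (Hk : IZR k = INR (S n)) by (symmetry; apply INR_IZR_INZ).
  assert (Hk0 : INR (S n) <> 0) by (apply not_0_INR; lia).
  assert (Hf0 : INR (fact n) <> 0) by (apply Rgt_not_eq, INR_fact_lt_0).
  assert (Ef : INR (fact (S n)) = INR (S n) * INR (fact n)) by apply (mult_INR (S n) (fact n)).
  assert (Hdp : IZR d ^ n <> 0) by (apply pow_nonzero; lra).
  assert (Hx : (1 / IZR d) ^ n = / IZR d ^ n).
  { unfold Rdiv. rewrite Rmult_1_l, pow_inv. reflexivity. }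
  rewrite !plus_IZR, !mult_IZR, !plus_IZR, Hf, Hp, He, Hl, Hr, Hk, Ef.
  cbn [exp_poly log_poly dilog_poly]. rewrite <- !tech_pow_Rmult, Hx.
  repeat split; field; repeat split; try assumption; lra.
Qed.

Lemma scaled_bounds (x c : R) (z w lo hi : Z) :
  IZR z = c * x -> IZR w = c -> (0 < w)%Z ->
  (lo * w <=? z * 10 ^ 15)%Z = true -> (z * 10 ^ 15 <=? hi * w)%Z = true ->
  IZR lo / 10 ^ 15 <= x <= IZR hi / 10 ^ 15.
Proof.
intros Hz Hw Hpos H1 H2. apply Z.leb_le, IZR_le in H1. apply Z.leb_le, IZR_le in H2.
apply IZR_lt in Hpos. rewrite !mult_IZR, Hz, Hw in H1. rewrite !mult_IZR, Hz, Hw in H2. rewrite Hw in Hpos.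
change (IZR (10 ^ 15)) with 1000000000000000 in H1. change (IZR (10 ^ 15)) with 1000000000000000 in H2.
split; [apply (Rmult_le_reg_l c); [exact Hpos | ] | apply (Rmult_le_reg_l c); [exact Hpos | ]]; lra.
Qed.

Definition decimal_between (lo hi z w : Z) : bool :=
  ((0 <? w) && (lo * w <=? z * 10 ^ 15) && (z * 10 ^ 15 <=? hi * w))%Z%bool.

Lemma decimal_between_correct (lo hi z w : Z) (x c : R) :
  decimal_between lo hi z w = true -> IZR z = c * x -> IZR w = c ->
  IZR lo / 10 ^ 15 <= x <= IZR hi / 10 ^ 15.
Proof.
unfold decimal_between. intros H Hz Hw.
apply andb_prop in H. destruct H as [H H3]. apply andb_prop in H. destruct H as [H1 H2].
apply (scaled_bounds x c z w); try assumption. apply Z.ltb_lt, H1.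
Qed.

(** The three tests bound [log_exp_coeff] at 31, the increment of [log_exp_rest]
from -1 to 31, and the Taylor error [exp_poly_tol 111], which equals
93 * 31^110 / (111 * 110!). The argument r stands for the sums at 31 and r' for
those at -1; keeping them variable lets proofs about the test be checked without
computing the sums. *)
Definition log_exp_check (r r' : log_exp_sums) : bool :=
  (decimal_between (-5329105020841085) (-5329105020841083) (z_log r) (z_fact r * z_fact r)
   && decimal_between (-13208408811874182) (-13208408811874180) (z_rest r - z_rest r')
        (z_fact r * z_fact r * z_fact r)
   && decimal_between 0 10 (93 * z_pow r) (111 * z_fact r))%Z%bool.

Lemma log_exp_check_true : log_exp_check (int_log_exp 31 110) (int_log_exp (-1) 110) = true.
Proof. vm_cast_no_check (eq_refl true). Qed.

Lemma exp_poly_tol_succ (n : nat) :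
  exp_poly_tol (S n) = 93 * 31 ^ n / (INR (S n) * INR (fact n)).
Proof.
unfold exp_poly_tol. rewrite <- mult_INR, <- (tech_pow_Rmult 31 n). change (fact (S n)) with (S n * fact n)%nat.
unfold Rdiv. ring.
Qed.

Lemma log_exp_bounds :
  (-5329105020841085 / 10 ^ 15 <= log_exp_coeff 110 31 <= -5329105020841083 / 10 ^ 15) /\
  (-13208408811874182 / 10 ^ 15 <= log_exp_rest 110 31 - log_exp_rest 110 (-1)
     <= -13208408811874180 / 10 ^ 15) /\
  0 / 10 ^ 15 <= exp_poly_tol 111 <= 10 / 10 ^ 15.
Proof.
pose proof log_exp_check_true as H.
destruct (int_log_exp_correct 31 110) as (Hf & Hp & _ & _ & Hl & Hr).
destruct (int_log_exp_correct (-1) 110) as (_ & _ & _ & _ & _ & Hr').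
revert H Hf Hp Hl Hr Hr'. generalize (int_log_exp 31 110) (int_log_exp (-1) 110).
intros r r' H Hf Hp Hl Hr Hr'. unfold log_exp_check in H.
apply andb_prop in H. destruct H as [H H3]. apply andb_prop in H. destruct H as [H1 H2].
pose proof (INR_fact_lt_0 110) as Hf0.
rewrite (exp_poly_tol_succ 110). replace (INR 111) with 111 by (rewrite INR_IZR_INZ; reflexivity).
revert Hf0 Hf Hl Hr Hr'. generalize (INR (fact 110)). intros f Hf0 Hf Hl Hr Hr'.
split; [ | split].
- apply (decimal_between_correct _ _ _ _ _ (f * f) H1); [exact Hl | ]. rewrite mult_IZR, Hf. reflexivity.
- apply (decimal_between_correct _ _ _ _ _ (f * f * f) H2).
  + rewrite minus_IZR, Hr, Hr'. ring.
  + rewrite !mult_IZR, Hf. reflexivity.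
- apply (decimal_between_correct _ _ _ _ _ (111 * f) H3).
  + rewrite mult_IZR, Hp. field. lra.
  + rewrite mult_IZR, Hf. reflexivity.
Qed.

(** The arguments stand for the sums at 1/2, at 1/32 and, for e, at 1. *)
Definition log_check (r r' r'' : inverse_sums) : bool :=
  (decimal_between 693147180559943 693147180559946 (i_log r) (i_pow r * i_fact r)
   && decimal_between 582240526465011 582240526465014 (i_dilog r) (i_pow r * i_fact r * i_fact r)
   && decimal_between 31748698314579 31748698314582 (i_log r') (i_pow r' * i_fact r')
   && decimal_between 31497592290229 31497592290232 (i_dilog r') (i_pow r' * i_fact r' * i_fact r')
   && decimal_between 2718281828458990 2718281828458998 (i_exp r'') (i_pow r'' * i_fact r''))%Z%bool.

Lemma log_check_true :
  log_check (int_inverse_sums 2 45) (int_inverse_sums 32 45) (int_inverse_sums 1 16) = true.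
Proof. vm_cast_no_check (eq_refl true). Qed.

Lemma log_bounds :
  (693147180559943 / 10 ^ 15 <= log_poly 45 (1 / 2) <= 693147180559946 / 10 ^ 15) /\
  (582240526465011 / 10 ^ 15 <= dilog_poly 45 (1 / 2) <= 582240526465014 / 10 ^ 15) /\
  (31748698314579 / 10 ^ 15 <= log_poly 45 (1 / 32) <= 31748698314582 / 10 ^ 15) /\
  (31497592290229 / 10 ^ 15 <= dilog_poly 45 (1 / 32) <= 31497592290232 / 10 ^ 15) /\
  (2718281828458990 / 10 ^ 15 <= exp_poly 16 1 <= 2718281828458998 / 10 ^ 15).
Proof.
pose proof log_check_true as H.
destruct (int_inverse_sums_correct 2 45 eq_refl) as (Ff & Fp & _ & Fl & Fd).
destruct (int_inverse_sums_correct 32 45 eq_refl) as (Gf & Gp & _ & Gl & Gd).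
destruct (int_inverse_sums_correct 1 16 eq_refl) as (Kf & Kp & Ke & _ & _).
replace (1 / 1) with 1 in Ke by lra.
revert H Ff Fp Fl Fd Gf Gp Gl Gd Kf Kp Ke.
generalize (INR (fact 45)) (INR (fact 16)) (int_inverse_sums 2 45) (int_inverse_sums 32 45) (int_inverse_sums 1 16).
intros f g r r' r'' H Ff Fp Fl Fd Gf Gp Gl Gd Kf Kp Ke. unfold log_check in H.
apply andb_prop in H. destruct H as [H H5]. apply andb_prop in H. destruct H as [H H4].
apply andb_prop in H. destruct H as [H H3]. apply andb_prop in H. destruct H as [H1 H2].
split; [ | split; [ | split; [ | split]]].
- apply (decimal_between_correct _ _ _ _ _ (2 ^ 45 * f) H1); [exact Fl | ].
  rewrite mult_IZR, Ff, Fp. reflexivity.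
- apply (decimal_between_correct _ _ _ _ _ (2 ^ 45 * f * f) H2); [exact Fd | ].
  rewrite !mult_IZR, Ff, Fp. reflexivity.
- apply (decimal_between_correct _ _ _ _ _ (32 ^ 45 * f) H3); [exact Gl | ].
  rewrite mult_IZR, Gf, Gp. reflexivity.
- apply (decimal_between_correct _ _ _ _ _ (32 ^ 45 * f * f) H4); [exact Gd | ].
  rewrite !mult_IZR, Gf, Gp. reflexivity.
- apply (decimal_between_correct _ _ _ _ _ (1 ^ 16 * g) H5); [exact Ke | ].
  rewrite mult_IZR, Kf, Kp. reflexivity.
Qed.

Lemma exp_1_bounds : 27182818284588 / 10 ^ 13 <= exp 1 <= 27182818284592 / 10 ^ 13.
Proof.
destruct log_bounds as (_ & _ & _ & _ & H).
assert (Hx : forall x, 0 <= x <= 1 -> exp (1 * x) <= 3) by (intros x Hx; apply exp_le_3_of_le_1; lra).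
pose proof (exp_poly_error 1 1 3 16 Rabs_R1 Hx 1 ltac:(lra)) as He.
rewrite Rmult_1_l in He.
assert (Hf : INR (fact 16) = 20922789888000).
{ destruct (int_inverse_sums_correct 1 16 eq_refl) as (Kf & _). rewrite <- Kf. f_equal. }
rewrite Hf in He. apply Rabs_le_between in He. lra.
Qed.

Lemma ln_2_bounds : 69314718055994 / 10 ^ 14 <= ln 2 <= 69314718055998 / 10 ^ 14.
Proof.
destruct log_bounds as (H & _).
pose proof (log_poly_error 45 (1 / 2) ltac:(lra)) as He.
replace (1 - 1 / 2) with (/ 2) in He by lra. rewrite ln_Rinv, Ropp_involutive in He by lra.
lra.
Qed.

Lemma slope_approx_bounds :
  3893138823121 / 10 ^ 12 <= slope_approx 110 45 <= 3893138823125 / 10 ^ 12.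
Proof.
destruct log_bounds as (H1 & H2 & H3 & H4 & _).
destruct log_exp_bounds as (H5 & H6 & _).
pose proof ln_2_bounds as H7. unfold slope_approx.
set (c := 2 * log_poly 45 (1 / 2) - 5 * log_poly 45 (1 / 32) + 5 * log_exp_coeff 110 31).
assert (Hc : - 2541797423465850 / 10 ^ 14 <= c <= - 2541797423465840 / 10 ^ 14) by (unfold c; lra).
(* c is negative, so the products are bounded with - c. *)
clearbody c. generalize dependent (ln 2). intros L HL.
assert (HL2 : (69314718055994 / 10 ^ 14) * (69314718055994 / 10 ^ 14) <= L * L
   <= (69314718055998 / 10 ^ 14) * (69314718055998 / 10 ^ 14)) by (split; apply Rmult_le_compat; lra).
assert (HLc : (69314718055994 / 10 ^ 14) * (2541797423465840 / 10 ^ 14) <= L * - c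
   <= (69314718055998 / 10 ^ 14) * (2541797423465850 / 10 ^ 14)) by (split; apply Rmult_le_compat; lra).
lra.
Qed.

Lemma exp_INR (n : nat) : exp (INR n) = exp 1 ^ n.
Proof.
induction n as [ | n IH]; [apply exp_0 | ].
rewrite S_INR, exp_plus, IH, <- tech_pow_Rmult. apply Rmult_comm.
Qed.

Lemma exp_neg_32_le : exp (-32) <= 1 / 10 ^ 13.
Proof.
assert (E : exp 32 = exp 1 ^ 32) by (rewrite <- exp_INR, INR_IZR_INZ; reflexivity).
pose proof exp_1_bounds as He.
assert (H : (27 / 10) ^ 32 <= exp 32) by (rewrite E; apply pow_incr; lra).
replace (-32) with (- (32)) by ring. rewrite exp_Ropp. unfold Rdiv. rewrite Rmult_1_l.
apply Rinv_le_contravar; lra.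
Qed.

Lemma slope_tolerance :
  12 * (2 * exp_poly_tol 111 + 2 * (1 / 2) ^ 45) + 3 * exp (-32) <= 2 / 10 ^ 12.
Proof.
destruct log_exp_bounds as (_ & _ & H). pose proof exp_neg_32_le. lra.
Qed.

(** * The convexity inequality *)

(** After the factor e^(yu) is taken out, the derivative compares the secant slopes
of e^(pu) for p = x - y and p = 1 - y. As H vanishes at 0, monotonicity
determines its sign on each side. *)
Lemma exp_three_point_increasing (x y : R) :
  0 < y < x -> x <= 1 -> 
  let c := x * (x - y) / (1 - y) in
  let H := fun u => c * ((exp (1 * u) - 1) - (exp (y * u) - 1) / y) - ((exp (x * u) - 1) - x / y * (exp (y * u) - 1)) in
  forall u v, u <= v -> H u <= H v.
Proof.
intros Hyx Hx c H u v Huv. apply le_of_derive_nonneg; [exact Huv | | ].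
- intros t _. apply (ex_derive_continuous (V := R_NormedModule)). unfold H. auto_derive. exact I.
- intros t _.
  exists (x * exp (y * t) * ((x - y) * (exp ((1 - y) * t) - 1) - (1 - y) * (exp ((x - y) * t) - 1)) / (1 - y)).
  split.
  + pose proof (exp_secant_le (x - y) (1 - y) t ltac:(lra)) as Hs.
    apply Rdiv_le_0_compat; [ | lra]. pose proof (exp_pos (y * t)).
    apply Rmult_le_pos; [apply Rmult_le_pos; lra | lra].
  + unfold H. auto_derive; [exact I | ].
    unfold c.
    assert (E1 : exp (1 * t) = exp (y * t) * exp ((1 - y) * t)) by (rewrite <- exp_plus; f_equal; ring).
    assert (E2 : exp (x * t) = exp (y * t) * exp ((x - y) * t)) by (rewrite <- exp_plus; f_equal; ring).
    rewrite E1, E2. field. lra.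
Qed.

(** The difference of the two sides is e^(-t) H(ln t)/(t - 1) with the increasing
function H above, and ln t and t - 1 have the same sign. *)
Lemma kurepa_density_three_point (x y t : R) :
  0 < y < x -> x <= 1 -> 0 < t ->
  kurepa_density x t - x / y * kurepa_density y t <=
  x * (x - y) / (1 - y) * (kurepa_density 1 t - kurepa_density y t / y).
Proof.
intros Hyx Hx Ht. set (c := x * (x - y) / (1 - y)).
pose proof (exp_three_point_increasing x y Hyx Hx) as Hm. cbv zeta in Hm. fold c in Hm.
set (H := fun u => c * ((exp (1 * u) - 1) - (exp (y * u) - 1) / y) - ((exp (x * u) - 1) - x / y * (exp (y * u) - 1))) in *.
assert (H0 : H 0 = 0) by (unfold H; rewrite !Rmult_0_r, exp_0; field; lra).
enough (Hk : 0 <= exp (- t) * (H (ln t) / (t - 1))).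
{ assert (E : c * (kurepa_density 1 t - kurepa_density y t / y) - (kurepa_density x t - x / y * kurepa_density y t)
    = exp (- t) * (H (ln t) / (t - 1))).
  { unfold kurepa_density, H, Rdiv. ring. }
  lra. }
apply Rmult_le_pos; [apply Rlt_le, exp_pos | ].
destruct (Rtotal_order t 1) as [Hlt | [-> | Hgt]].
- assert (Hl : H (ln t) <= 0).
  { rewrite <- H0. apply Hm. rewrite <- ln_1. apply Rlt_le, ln_increasing; lra. }
  replace (H (ln t) / (t - 1)) with (- H (ln t) / (1 - t)) by (field; lra).
  apply Rdiv_le_0_compat; lra.
- rewrite ln_1, H0. unfold Rdiv. rewrite Rmult_0_l. lra.
- assert (Hl : 0 <= H (ln t)).
  { rewrite <- H0. apply Hm. rewrite <- ln_1. apply Rlt_le, ln_increasing; lra. }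
  apply Rdiv_le_0_compat; lra.
Qed.

(** Away from t = 1 the integrand is e^(-t). *)
Lemma kurepa_density_1_integral_le (b J : R) :
  1 <= b -> is_RInt (kurepa_density 1) 0 b J -> J <= 1.
Proof.
intros Hb HJ.
destruct (RInt_split _ 0 1 b J ltac:(lra) HJ) as (I1 & I2 & H1 & H2 & E).
assert (Hp : forall u v I, 0 <= u <= v -> (v <= 1 \/ 1 <= u) -> is_RInt (kurepa_density 1) u v I ->
  I <= - exp (- v) - - exp (- u)).
{ intros u v I Huv Hout HI.
  apply (RInt_le_primitive (kurepa_density 1) (fun t => - exp (- t)) u v I); [lra | exact HI | | | ].
  - intros t Ht. apply continuous_kurepa_density; lra.
  - intros t Ht. apply (ex_derive_continuous (V := R_NormedModule)). auto_derive. exact Logic.I.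
  - intros t Ht. exists (exp (- t)). split; [auto_derive; [exact Logic.I | ring] | ].
    unfold kurepa_density. rewrite Rmult_1_l, exp_ln by lra. right. field. lra. }
pose proof (Hp 0 1 I1 ltac:(lra) ltac:(lra) H1) as B1. pose proof (Hp 1 b I2 ltac:(lra) ltac:(lra) H2) as B2.
rewrite Ropp_0, exp_0 in B1. pose proof (exp_pos (- b)). lra.
Qed.

(** * From the integrals to K *)

Lemma kurepa_integrand_real (x t : R) :
  kurepa_integrand (RtoC x) t = RtoC (kurepa_density x t).
Proof.
unfold kurepa_integrand, Rpower_C, kurepa_density.
assert (E : Cexp (RtoC x * RtoC (ln t)) = RtoC (exp (x * ln t))).
{ rewrite <- RtoC_mult. unfold Cexp. simpl. rewrite cos_0, sin_0. unfold RtoC. f_equal; ring. }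
rewrite E, <- !RtoC_minus.
assert (Ei : (/ RtoC (t - 1) = RtoC (/ (t - 1)))%C).
(* At t = 1 both sides use the value 0 of an inverse of 0. *)
{ destruct (Req_dec (t - 1) 0) as [-> | Hn].
  - unfold Cinv, RtoC; simpl. rewrite Rinv_0. f_equal; unfold Rdiv; ring.
  - symmetry. now apply RtoC_inv. }
unfold Cdiv. rewrite Ei, <- !RtoC_mult. reflexivity.
Qed.

Lemma kurepa_truncation (K : C -> C) (hK : is_kurepa K) (x eps : R) :
  0 < x -> 0 < eps ->
  exists B, forall b, B < b ->
    exists I, is_RInt (kurepa_density x) 0 b I /\ Rabs (I - Re (K (RtoC x))) < eps
      /\ Rabs (Im (K (RtoC x))) < eps.
Proof.
intros Hx He.
pose proof (kurepa_integral K hK (RtoC x) Hx) as Hi.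
specialize (Hi (ball (M := C_R_NormedModule) (K (RtoC x)) eps) (locally_ball (K (RtoC x)) (mkposreal eps He))).
destruct Hi as [Q P HQ HP Himp].
destruct HP as [B HB]. exists B. intros b Hb.
destruct (Himp 0 b HQ (HB b Hb)) as [I [HI [Hb1 Hb2]]].
exists (fst I). simpl in HI.
split; [ | split].
- apply (is_RInt_ext (fun t => fst (kurepa_integrand (RtoC x) t))).
  { intros t _. rewrite kurepa_integrand_real. reflexivity. }
  apply (is_RInt_fct_extend_fst (U := R_NormedModule) (V := R_NormedModule) (kurepa_integrand (RtoC x))). exact HI.
- exact Hb1.
- assert (H0 : snd I = 0).
  { apply (is_RInt_fct_extend_snd (U := R_NormedModule) (V := R_NormedModule) (kurepa_integrand (RtoC x))) in HI.
    apply (is_RInt_unique (V := R_CompleteNormedModule)) in HI.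
    etransitivity; [symmetry; exact HI | ].
    rewrite (RInt_ext (V := R_CompleteNormedModule) _ (fun _ => 0)).
    - rewrite RInt_const. apply (scal_zero_r (V := R_NormedModule)).
    - intros t _. rewrite kurepa_integrand_real. reflexivity. }
  change (Rabs (snd I - Im (K (RtoC x))) < eps) in Hb2. rewrite H0 in Hb2.
  rewrite <- Rabs_Ropp. replace (- Im (K (RtoC x))) with (0 - Im (K (RtoC x))) by ring. exact Hb2.
Qed.

Lemma kurepa_Im (K : C -> C) (hK : is_kurepa K) (x : R) : 0 < x -> Im (K (RtoC x)) = 0.
Proof.
intros Hx. assert (H : Rabs (Im (K (RtoC x))) <= 0).
{ apply le_of_forall_pos. intros eps He. destruct (kurepa_truncation K hK x eps Hx He) as [B HB].
  destruct (HB (B + 1) ltac:(lra)) as [I [_ [_ H]]]. lra. }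
apply Rabs_le_between in H. lra.
Qed.

(** The choice 110, 45 of truncation orders keeps everything that does not vanish
with y below 2 10^(-12). *)
Lemma kurepa_slope (K : C -> C) (hK : is_kurepa K) (y : R) :
  0 < y <= 1 ->
  Rabs (exp 1 * (Re (K (RtoC y)) / y) - slope_approx 110 45) <= 73728 * y + 2 / 10 ^ 12.
Proof.
intros Hy. apply le_of_forall_pos. intros eps He.
assert (He' : 0 < eps * y / 3)
  by (apply Rdiv_lt_0_compat; [apply Rmult_lt_0_compat | ]; lra).
destruct (kurepa_truncation K hK y (eps * y / 3) ltac:(lra) He') as [B HB].
pose proof (Rmax_l B 32). pose proof (Rmax_r B 32).
destruct (HB (Rmax B 32 + 1) ltac:(lra)) as [I [HI [Hd _]]].
pose proof (kurepa_integral_0_b 110 45 y (Rmax B 32 + 1) I Hy ltac:(lra) HI) as Hn.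
pose proof slope_tolerance. pose proof exp_le_3. pose proof (exp_pos 1).
set (L := Re (K (RtoC y))) in *.
assert (Hd' : Rabs (exp 1 * (L / y) - exp 1 * (I / y)) <= eps).
{ replace (exp 1 * (L / y) - exp 1 * (I / y)) with (- (exp 1 / y * (I - L))) by (field; lra).
  rewrite Rabs_Ropp, Rabs_mult, Rabs_pos_eq by (apply Rdiv_le_0_compat; lra).
  apply Rle_trans with (3 / y * (eps * y / 3)); [ | right; field; lra].
  apply Rmult_le_compat; [apply Rdiv_le_0_compat; lra | apply Rabs_pos | | lra].
  apply Rmult_le_compat_r; [apply Rlt_le, Rinv_0_lt_compat; lra | lra]. }
replace (exp 1 * (L / y) - slope_approx 110 45) with
  ((exp 1 * (L / y) - exp 1 * (I / y)) + (exp 1 * (I / y) - slope_approx 110 45)) by ring.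
eapply Rle_trans; [apply Rabs_triang | ]. lra.
Qed.

Lemma kurepa_1_le (K : C -> C) (hK : is_kurepa K) : Re (K (RtoC 1)) <= 1.
Proof.
apply le_of_forall_pos. intros eps He.
destruct (kurepa_truncation K hK 1 eps ltac:(lra) He) as [B HB].
pose proof (Rmax_l B 1). pose proof (Rmax_r B 1).
destruct (HB (Rmax B 1 + 1) ltac:(lra)) as [I [HI [Hd _]]].
pose proof (kurepa_density_1_integral_le (Rmax B 1 + 1) I ltac:(lra) HI).
apply Rabs_def2 in Hd. lra.
Qed.

Lemma kurepa_three_point (K : C -> C) (hK : is_kurepa K) (x y : R) :
  0 < y < x -> x <= 1 ->
  Re (K (RtoC x)) - x / y * Re (K (RtoC y)) <=
  x * (x - y) / (1 - y) * (Re (K (RtoC 1)) - Re (K (RtoC y)) / y).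
Proof.
intros Hyx Hx. set (c := x * (x - y) / (1 - y)).
assert (Hc : 0 <= c) by (apply Rdiv_le_0_compat; nra).
assert (Hxy : 0 < x / y) by (apply Rdiv_lt_0_compat; lra).
assert (Hiy : 0 < / y) by (apply Rinv_0_lt_compat; lra).
assert (Hcy : 0 <= c / y) by (apply Rmult_le_pos; lra).
(* S is the total weight of the three truncation errors in the inequality. *)
set (S := 1 + x / y + c + c / y).
apply le_of_forall_pos. intros eps He.
assert (He' : 0 < eps / S) by (apply Rdiv_lt_0_compat; unfold S; lra).
destruct (kurepa_truncation K hK x (eps / S) ltac:(lra) He') as [Bx HBx].
destruct (kurepa_truncation K hK y (eps / S) ltac:(lra) He') as [By HBy].
destruct (kurepa_truncation K hK 1 (eps / S) ltac:(lra) He') as [B1 HB1].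
set (b := Rmax (Rmax Bx By) (Rmax B1 0) + 1).
pose proof (Rmax_l (Rmax Bx By) (Rmax B1 0)). pose proof (Rmax_r (Rmax Bx By) (Rmax B1 0)).
pose proof (Rmax_l Bx By). pose proof (Rmax_r Bx By). pose proof (Rmax_l B1 0). pose proof (Rmax_r B1 0).
destruct (HBx b ltac:(unfold b; lra)) as [Ix [HIx [Dx _]]].
destruct (HBy b ltac:(unfold b; lra)) as [Iy [HIy [Dy _]]].
destruct (HB1 b ltac:(unfold b; lra)) as [I1 [HI1 [D1 _]]].
assert (Hle : Ix - x / y * Iy <= c * (I1 - / y * Iy)).
{ apply (is_RInt_le (fun t => kurepa_density x t - x / y * kurepa_density y t)
    (fun t => c * (kurepa_density 1 t - / y * kurepa_density y t)) 0 b).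
  - unfold b; lra.
  - apply (is_RInt_minus (V := R_NormedModule)); [exact HIx | ].
    apply (is_RInt_scal (V := R_NormedModule)), HIy.
  - apply (is_RInt_scal (V := R_NormedModule)), (is_RInt_minus (V := R_NormedModule)); [exact HI1 | ].
    apply (is_RInt_scal (V := R_NormedModule)), HIy.
  - intros t Ht. rewrite (Rmult_comm (/ y)). apply kurepa_density_three_point; lra. }
apply Rabs_def2 in Dx. apply Rabs_def2 in Dy. apply Rabs_def2 in D1.
set (d := eps / S) in *.
assert (HS : eps = d + x / y * d + c * d + c / y * d) by (replace eps with (S * d) by (unfold d; field; unfold S; lra); unfold S; ring).
set (Lx := Re (K (RtoC x))) in *. set (Ly := Re (K (RtoC y))) in *. set (L1 := Re (K (RtoC 1))) in *.
assert (G1 : x / y * (Iy - Ly) <= x / y * d) by (apply Rmult_le_compat_l; lra).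
assert (G2 : c * (I1 - L1) <= c * d) by (apply Rmult_le_compat_l; lra).
assert (G3 : c / y * (Ly - Iy) <= c / y * d) by (apply Rmult_le_compat_l; lra).
assert (E1 : c * (L1 - Ly / y) = c * L1 - c / y * Ly) by (unfold Rdiv; ring).
assert (E2 : c * (I1 - / y * Iy) = c * I1 - c / y * Iy) by (unfold Rdiv; ring).
lra.
Qed.

Lemma kurepa_abs_le (K : C -> C) (hK : is_kurepa K) (y : R) : 0 < y <= 1 -> Rabs (Re (K (RtoC y))) <= 100000 * y.
Proof.
intros Hy. pose proof (kurepa_slope K hK y Hy) as H. pose proof slope_approx_bounds as HV.
pose proof exp_1_bounds as He.
set (L := Re (K (RtoC y))) in *.
assert (EL : L = L / y * y) by (field; lra).
apply Rabs_le_between in H. set (w := L / y) in *.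
assert (- 100000 <= w <= 100000) by nra.
rewrite EL. apply Rabs_le. nra.
Qed.

Lemma kurepa_first_order (K : C -> C) (l : C) :
  @is_derive C_AbsRing C_NormedModule K (RtoC 0) l ->
  forall eps, 0 < eps -> exists d, 0 < d /\ forall y, 0 < y < d ->
    Rabs (Re (K (RtoC y)) - Re (K (RtoC 0)) - y * Re l) <= eps * y /\
    Rabs (Im (K (RtoC y)) - Im (K (RtoC 0)) - y * Im l) <= eps * y.
Proof.
intros [_ Hd] eps He.
destruct (Hd (RtoC 0) (fun P HP => HP) (mkposreal eps He)) as [d Hdd].
exists d. split; [apply cond_pos | ]. intros y Hy.
assert (Hb : @ball (AbsRing_UniformSpace C_AbsRing) (RtoC 0) d (RtoC y)).
{ change (Cmod (RtoC y - RtoC 0) < d). rewrite <- RtoC_minus, Cmod_R, Rminus_0_r, Rabs_pos_eq; lra. }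
specialize (Hdd (RtoC y) Hb).
change (Cmod ((K (RtoC y) - K (RtoC 0)) - (RtoC y - RtoC 0) * l) <= eps * Cmod (RtoC y - RtoC 0)) in Hdd.
rewrite <- RtoC_minus, Cmod_R, Rminus_0_r, Rabs_pos_eq in Hdd by lra.
set (z := ((K (RtoC y) - K (RtoC 0)) - RtoC y * l)%C) in *.
pose proof (Rmax_Cmod z) as Hz.
pose proof (Rmax_l (Rabs (fst z)) (Rabs (snd z))). pose proof (Rmax_r (Rabs (fst z)) (Rabs (snd z))).
assert (E1 : Re (K (RtoC y)) - Re (K (RtoC 0)) - y * Re l = fst z) by (unfold z, Re, Im; simpl; ring).
assert (E2 : Im (K (RtoC y)) - Im (K (RtoC 0)) - y * Im l = snd z) by (unfold z, Re, Im; simpl; ring).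
rewrite E1, E2. split; lra.
Qed.

(** This recovers the value K(0) from first-order information at 0 and a linear bound
on the positive side. *)
Lemma constant_term_eq_0 (r : R -> R) (a l M : R) :
  (forall y, 0 < y <= 1 -> Rabs (r y) <= M * y) ->
  (exists d, 0 < d /\ forall y, 0 < y < d -> Rabs (r y - a - y * l) <= 1 * y) ->
  a = 0.
Proof.
intros Hr [d [Hd Hy]]. apply eq_0_of_small. intros eps He.
pose proof (Rabs_pos l) as Hlp. pose proof (Rabs_pos M) as HMp. pose proof (Rle_abs M) as HM.
set (D := Rabs M + 1 + Rabs l). assert (HD : 0 < D) by (unfold D; lra).
assert (HeD : 0 < eps / D) by (apply Rdiv_lt_0_compat; lra).
set (y := Rmin (d / 2) (Rmin 1 (eps / D))).
assert (Hy0 : 0 < y) by (repeat apply Rmin_glb_lt; lra).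
pose proof (Rmin_l (d / 2) (Rmin 1 (eps / D))). pose proof (Rmin_r (d / 2) (Rmin 1 (eps / D))).
pose proof (Rmin_l 1 (eps / D)). pose proof (Rmin_r 1 (eps / D)). fold y in H, H0.
specialize (Hy y ltac:(lra)). specialize (Hr y ltac:(lra)).
assert (H5 : y * D <= eps) by (apply Rle_div_r; lra).
replace a with (r y + - (r y - a - y * l) + - (y * l)) by ring.
eapply Rle_trans; [apply Rabs_triang | ]. rewrite Rabs_Ropp, Rabs_mult, (Rabs_pos_eq y) by lra.
pose proof (Rabs_triang (r y) (- (r y - a - y * l))) as H6. rewrite Rabs_Ropp in H6.
assert (H7 : M * y <= Rabs M * y) by (apply Rmult_le_compat_r; lra).
unfold D in H5. lra.
Qed.

Lemma kurepa_at_0 (K : C -> C) (hK : is_kurepa K) (l : C) :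
  @is_derive C_AbsRing C_NormedModule K (RtoC 0) l ->
  K (RtoC 0) = RtoC 0 /\ Im l = 0.
Proof.
intros Hl. pose proof (kurepa_first_order K l Hl) as Hf.
destruct (Hf 1 Rlt_0_1) as [d1 [Hd1 Hy1]].
assert (HRe : Re (K (RtoC 0)) = 0).
{ apply (constant_term_eq_0 (fun y => Re (K (RtoC y))) _ (Re l) 100000).
  - intros y Hy. now apply kurepa_abs_le.
  - exists d1. split; [exact Hd1 | ]. intros y Hy. apply (Hy1 y Hy). }
assert (HIm : Im (K (RtoC 0)) = 0).
{ apply (constant_term_eq_0 (fun y => Im (K (RtoC y))) _ (Im l) 0).
  - intros y Hy. rewrite (kurepa_Im K hK) by apply Hy. rewrite Rabs_R0. lra.
  - exists d1. split; [exact Hd1 | ]. intros y Hy. apply (Hy1 y Hy). }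
split; [now apply injective_projections | ].
apply eq_0_of_small. intros eps He. destruct (Hf eps He) as [d [Hd Hy]].
destruct (Hy (d / 2) ltac:(lra)) as [_ H]. rewrite (kurepa_Im K hK), HIm in H by lra.
replace (0 - 0 - d / 2 * Im l) with (- (d / 2 * Im l)) in H by ring.
rewrite Rabs_Ropp, Rabs_mult, Rabs_pos_eq in H by lra.
apply (Rmult_le_reg_l (d / 2)); lra.
Qed.

Theorem theorem1p2 (K : C -> C) (hK : is_kurepa K) :
  exists k : R,
    @is_derive C_AbsRing C_NormedModule K (RtoC 0) (RtoC k) /\
    (forall x : R, 0 <= x <= 1 ->
       Im (K (RtoC x)) = 0 /\ Re (K (RtoC x)) <= k * x) /\
    Rabs (k - 1432205735 / 1000000000) <= 5 / 10000000000 /\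
    (forall c : R,
       (forall x : R, 0 <= x <= 1 -> Re (K (RtoC x)) <= c * x) -> k <= c).
Proof.
assert (H0 : ~ kurepa_pole (RtoC 0)).
{ intros [H | [n [Hn H]]]; apply (f_equal Re) in H; simpl in H; [lra | ].
  pose proof (lt_0_INR n ltac:(lia)). lra. }
destruct (kurepa_analytic K hK (RtoC 0) H0) as [l Hl].
destruct (kurepa_at_0 K hK l Hl) as [HK0 HIm].
set (k := Re l).
assert (El : l = RtoC k) by (apply injective_projections; [reflexivity | exact HIm]).
assert (Hfo : forall eps, 0 < eps -> exists d, 0 < d /\ d <= 1 /\ forall y, 0 < y < d ->
  Rabs (Re (K (RtoC y)) / y - k) <= eps).
{ intros eps He. destruct (kurepa_first_order K l Hl eps He) as [d [Hd Hy]].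
  exists (Rmin d 1). split; [apply Rmin_glb_lt; lra | ]. split; [apply Rmin_r | ].
  intros y Hyd. pose proof (Rmin_l d 1). destruct (Hy y ltac:(lra)) as [H1 _].
  rewrite HK0 in H1. simpl in H1. rewrite Rminus_0_r in H1. fold k in H1.
  replace (Re (K (RtoC y)) / y - k) with ((Re (K (RtoC y)) - y * k) / y) by (field; lra).
  unfold Rdiv. rewrite Rabs_mult, (Rabs_pos_eq (/ y)) by (apply Rlt_le, Rinv_0_lt_compat; lra).
  apply Rle_div_l; lra. }
assert (Hnum : Rabs (k - 1432205735 / 1000000000) <= 5 / 10000000000).
{ destruct (Hfo (1 / 10 ^ 12) ltac:(lra)) as [d [Hd [Hd1 Hy]]].
  set (y := Rmin (d / 2) (1 / 10 ^ 18)).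
  assert (Hy0 : 0 < y) by (apply Rmin_glb_lt; lra).
  pose proof (Rmin_l (d / 2) (1 / 10 ^ 18)). pose proof (Rmin_r (d / 2) (1 / 10 ^ 18)). fold y in H, H1.
  specialize (Hy y ltac:(lra)). pose proof (kurepa_slope K hK y ltac:(lra)) as Hs.
  pose proof slope_approx_bounds as HV. pose proof exp_1_bounds as He.
  set (w := Re (K (RtoC y)) / y) in *.
  apply Rabs_le_between in Hs. apply Rabs_le_between in Hy. apply Rabs_le. 
  assert (Hw1 : w <= 14322057347 / 10 ^ 10).
  { apply Rnot_lt_le. intros Hc.
    assert (exp 1 * (14322057347 / 10 ^ 10) <= exp 1 * w) by (apply Rmult_le_compat_l; lra). lra. }
  assert (Hw2 : 14322057346 / 10 ^ 10 <= w).
  { apply Rnot_lt_le. intros Hc.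
    assert (exp 1 * w <= exp 1 * (14322057346 / 10 ^ 10)) by (apply Rmult_le_compat_l; lra). lra. }
  lra. }
exists k. split; [rewrite <- El; exact Hl | ]. split; [ | split; [exact Hnum | ]].
- intros x Hx. destruct (Rle_lt_or_eq_dec 0 x (proj1 Hx)) as [Hx0 | <-].
  + split; [now apply kurepa_Im | ].
    apply le_of_forall_pos. intros eps He.
    set (e := Rmin eps (1 / 10)). assert (He0 : 0 < e) by (apply Rmin_glb_lt; lra).
    pose proof (Rmin_l eps (1 / 10)). pose proof (Rmin_r eps (1 / 10)). fold e in H, H1.
    destruct (Hfo e He0) as [d [Hd [Hd1 Hy]]].
    set (y := Rmin (d / 2) (x / 2)). assert (Hy0 : 0 < y) by (apply Rmin_glb_lt; lra).
    pose proof (Rmin_l (d / 2) (x / 2)). pose proof (Rmin_r (d / 2) (x / 2)). fold y in H2, H3.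
    specialize (Hy y ltac:(lra)).
    pose proof (kurepa_three_point K hK x y ltac:(lra) ltac:(lra)) as H3p.
    pose proof (kurepa_1_le K hK) as HK1.
    assert (Hc : 0 <= x * (x - y) / (1 - y)) by (apply Rdiv_le_0_compat; nra).
    replace (x / y * Re (K (RtoC y))) with (x * (Re (K (RtoC y)) / y)) in H3p by (field; lra).
    set (w := Re (K (RtoC y)) / y) in *.
    apply Rabs_le_between in Hnum. apply Rabs_le_between in Hy.
    (* The slope w at y is within 1/10 of k, hence larger than K(1), so that the
       right-hand side of the three-point inequality is nonpositive. *)
    assert (x * (x - y) / (1 - y) * (Re (K (RtoC 1)) - w) <= 0).
    { rewrite <- (Rmult_0_r (x * (x - y) / (1 - y))). apply Rmult_le_compat_l; lra. }
    nra.
  + rewrite HK0. simpl. split; lra.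
- intros c Hc. apply le_of_forall_pos. intros eps He.
  destruct (Hfo eps He) as [d [Hd [Hd1 Hy]]].
  specialize (Hy (d / 2) ltac:(lra)). specialize (Hc (d / 2) ltac:(lra)).
  apply (Rle_div_l _ _ (d / 2) ltac:(lra)) in Hc.
  apply Rabs_le_between in Hy. lra.
Qed.
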